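(* The category of $B_\infty$ algebras, the category of conilpotent 2-associative differential bialgebras, and the category of cofree 2-associative differential bialgebras are equivalent.
   Context: Conventions. Vector spaces are $\mathbb Z$-graded over a field $\mathbb K$; maps have degree $0$ unless stated otherwise; the Koszul sign rule is used: $(f\otimes g)(a\otimes b)=(-1)^{|g||a|}f(a)\otimes g(b)$ and the symmetry is $a\otimes b\mapsto(-1)^{|a||b|}b\otimes a$. Coalgebras. A unital coalgebra $(C,\Delta,\varepsilon,1)$ is a counital coassociative coalgebra with a specified group-like element $1$ ($\Delta(1)=1\otimes1$). Put $\overline C=\ker\varepsilon$ and $\overline\Delta(x)=\Delta(x)-x\otimes1-1\otimes x\in\overline C\otimes\overline C$ for $x\in\overline C$. $C$ is conilpotent if for each $x\in\overline C$ there is $r$ with $\overline\Delta^{(r)}(x)=0$, where $\overline\Delta^{(r)}\colon\overline C\to\overline C^{\otimes(r+1)}$ is the $r$-fold iterate. The tensor coalgebra is $T^c(X)=\bigoplus_{k\ge0}X^{\otimes k}$ with deconcatenation $\Delta(x_1\cdots x_k)=\sum_{i=0}^k x_1\cdots x_i\otimes x_{i+1}\cdots x_k$, counit the projection to $X^{\otimes0}=\mathbb K$, and unit $1=1_{\mathbb K}$; $p_1\colon T^c(X)\to X$ is the projection. $C$ is cofree if it is isomorphic, as a unital coalgebra, to some $T^c(X)$. $B_\infty$ algebra (in the shifted convention). A $B_\infty$ structure on $X$ is a pair $(\mu,d)$ where $\mu\colon T^c(X)\otimes T^c(X)\to T^c(X)$ is a coalgebra map of degree $0$ that is associative with unit $1$,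 and $d\colon T^c(X)\to T^c(X)$ is a coderivation ($\Delta d=(d\otimes\mathrm{id}+\mathrm{id}\otimes d)\Delta$) of degree $-1$ with $d(1)=0$, $d^2=0$ and $d\mu=\mu(d\otimes\mathrm{id}+\mathrm{id}\otimes d)$. Its structure maps are $m_n=p_1d|_{X^{\otimes n}}$ ($n\ge1$) and $m_{i,j}=p_1\mu|_{X^{\otimes i}\otimes X^{\otimes j}}$ ($i,j\ge1$). Homomorphisms of $B_\infty$ algebras are degree $0$ linear maps $f\colon X\to Y$ commuting with all structure maps. 2-associative differential bialgebra. A 2-associative differential algebra is a (unital associative) differential graded algebra $(V,\bullet,1,\partial)$, with $\partial$ of degree $-1$, together with a second associative operation $\odot$ with the same unit $1$ and no further compatibility. A 2-associative differential bialgebra is a 2-associative differential algebra $(V,\partial,\bullet,\odot,1)$ with a comultiplication $\Delta$ (and counit $\varepsilon$) such that $(V,\partial,\bullet,\Delta,1)$ is a differential graded bialgebra (a bialgebra, with $\partial$ both a derivation of $\bullet$ and a coderivation of $\Delta$), and $(V,\odot,\Delta,1)$ is a unital infinitesimal bialgebra, i.e. $\Delta(x\odot y)=x_{(1)}\otimes (x_{(2)}\odot y)+(x\odot y_{(1)})\otimes y_{(2)}-x\otimes y$ in Sweedler notation. Homomorphisms are degree $0$ linear maps preserving all the structure. It is called conilpotent, respectively cofree, if it is so as a unital coalgebra; these give full subcategories of the category of 2-associative differential bialgebras. *)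

(* Defs.v *)
From HB Require Import structures.
From mathcomp Require Import all_boot all_order all_algebra.
From mathcomp Require Import generic_quotient ring_quotient.
From mathcomp Require Import boolp classical_sets fsbigop.
From mathcomp Require Import freeg.

Set Implicit Arguments.
Unset Strict Implicit.
Unset Printing Implicit Defensive.

Import GRing.Theory.
Local Open Scope ring_scope.

Lemma linear_ext (K : fieldType) (U V : lmodType K) (f g : {linear U -> V}) :
  f =1 g -> f = g.
Proof.
move=> /funext fg; case: f fg => f cf; case: g => g cg /= fg; subst g.
congr GRing.Linear.Pack; case: cf => [[a1] [z1]]; case: cg => [[a2] [z2]].
by rewrite (Prop_irrelevance a1 a2) (Prop_irrelevance z1 z2).
Qed.

Section Span.
Variables (K : fieldType) (V : lmodType K) (G : V -> Prop).

Inductive span : V -> Prop :=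
| span0 : span 0
| spanD a u v : G u -> span v -> span (a *: u + v).

Lemma span_add x y : span x -> span y -> span (x + y).
Proof.
elim=> [|a r s hr _ IH] hy; first by rewrite add0r.
by rewrite -addrA; apply: spanD => //; apply: IH.
Qed.

Lemma span_scale a x : span x -> span (a *: x).
Proof.
elim=> [|b r s hr _ IH]; first by rewrite scaler0; exact: span0.
by rewrite scalerDr scalerA; apply: spanD.
Qed.

Lemma span_gen x : G x -> span x.
Proof.
by move=> h; rewrite -[x]addr0 -[x]scale1r; apply: spanD => //; exact: span0.
Qed.

Lemma span_sum (I : Type) (r : seq I) (F : I -> V) :
  (forall i, span (F i)) -> span (\sum_(i <- r) F i).
Proof.
by move=> h; elim/big_rec: _ => [|i x _ hx]; [exact: span0|exact: span_add].
Qed.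

End Span.

Lemma span_linear_eq (K : fieldType) (V U : lmodType K) (G : V -> Prop)
    (f g : {linear V -> U}) :
  (forall u, G u -> f u = g u) -> forall v, span G v -> f v = g v.
Proof.
move=> h v; elim=> [|a u {}v hu _ IH]; first by rewrite !linear0.
by rewrite !linearP h // IH.
Qed.

(* The vector space with generators S and relations r = 0 for r in rel. *)
Section Presentation.
Variables (K : fieldType) (S : choiceType).
Local Notation Free := {freeg S / K}.
Variable rel : Free -> Prop.

Definition spanb : {pred Free} := fun x => `[< span rel x >].

Lemma spanb_closed : zmod_closed spanb.
Proof.
split=> [|x y /asboolP hx /asboolP hy]; apply/asboolP; first exact: span0.
by apply: span_add => //; rewrite -scaleN1r; apply: span_scale.
Qed.
HB.instance Definition _ := GRing.isZmodClosed.Build Free spanb spanb_closed.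

Definition pres := @Quotient.quot Free spanb.
HB.instance Definition _ := GRing.Zmodule.on pres.
HB.instance Definition _ := ZmodQuotient.on pres.

Definition pcls (x : Free) : pres := \pi_pres%qT x.

Lemma pcls_add x y : pcls (x + y) = pcls x + pcls y.
Proof. by rewrite /pcls raddfD. Qed.

Lemma pclsP x y : pcls x = pcls y <-> span rel (x - y).
Proof.
split.
  by move/eqP; rewrite -Quotient.idealrBE => /asboolP.
by move=> h; apply/eqP; rewrite -Quotient.idealrBE; apply/asboolP.
Qed.

Lemma pcls_repr q : pcls (repr q) = q.
Proof. exact: reprK. Qed.

Definition pscale a (q : pres) : pres := pcls (a *: repr q).

Lemma pscale_cls a x : pscale a (pcls x) = pcls (a *: x).
Proof.
apply/pclsP; rewrite -scalerBr; apply: span_scale; apply/pclsP.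
exact: pcls_repr.
Qed.

Fact pscaleA a b q : pscale a (pscale b q) = pscale (a * b) q.
Proof. by rewrite {2}/pscale pscale_cls scalerA. Qed.
Fact pscale1 : left_id 1 pscale.
Proof. by move=> q; rewrite /pscale scale1r pcls_repr. Qed.
Fact pscaleDr : right_distributive pscale +%R.
Proof.
move=> a p q; rewrite -[p]pcls_repr -[q]pcls_repr -pcls_add !pscale_cls.
by rewrite scalerDr pcls_add.
Qed.
Fact pscaleDl q : {morph pscale^~ q : a b / a + b}.
Proof.
move=> a b; rewrite -[q]pcls_repr !pscale_cls.
by rewrite scalerDl pcls_add.
Qed.
HB.instance Definition _ :=
  GRing.Zmodule_isLmodule.Build K pres pscaleA pscale1 pscaleDr pscaleDl.

Lemma pcls_scale a x : pcls (a *: x) = a *: pcls x.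
Proof. by rewrite -pscale_cls. Qed.

Definition pgen (s : S) : pres := pcls << s >>.

Lemma pgen_ind (P : pres -> Prop) :
  P 0 -> (forall a s q, P q -> P (a *: pgen s + q)) -> forall q, P q.
Proof.
move=> P0 PD q; rewrite -[q]pcls_repr -[repr q]freeg_sumE.
elim: (dom _) => [|s l IH].
  by rewrite big_nil; have -> : pcls 0 = 0 by rewrite /pcls raddf0.
rewrite big_cons pcls_add; set c := coeff _ _.
have -> : (<< c *g s >> : Free) = c *: << s >>.
  apply/eqP/freeg_eqP => x; rewrite coeffZ !coeffU mul1r //.
by rewrite pcls_scale; apply: PD.
Qed.

Definition plift (U : lmodType K) (F : S -> U) (q : pres) : U :=
  fglift F (repr q).

Section Lift.
Variables (U : lmodType K) (F : S -> U).

HB.instance Definition _ :=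
  GRing.isZmodMorphism.Build Free U (fglift F) (lift_is_additive F).

Lemma fglift_linear : linear (fglift F).
Proof.
move=> a x y; rewrite raddfD /=; congr (_ + _).
rewrite -[x]freeg_sumE scaler_sumr !raddf_sum /=.
apply: eq_bigr => s _; set c := coeff _ _.
have -> : a *: (<< c *g s >> : Free) = << a * c *g s >>.
  by apply/eqP/freeg_eqP => t; rewrite coeffZ !coeffU mulrA.
by rewrite !liftU scalerA.
Qed.

Lemma fglift_scale a x : fglift F (a *: x) = a *: fglift F x.
Proof. by rewrite -[a *: x]addr0 fglift_linear raddf0 addr0. Qed.

Hypothesis Frel : forall r, rel r -> fglift F r = 0.

Lemma fglift_span r : span rel r -> fglift F r = 0.
Proof.
elim=> [|a {}r s hr _ IH]; first exact: raddf0.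
by rewrite fglift_linear IH Frel // scaler0 addr0.
Qed.

Lemma plift_cls x : plift F (pcls x) = fglift F x.
Proof.
apply/eqP; rewrite -subr_eq0 -raddfB; apply/eqP; apply: fglift_span.
by apply/pclsP; rewrite pcls_repr.
Qed.

Lemma plift_gen s : plift F (pgen s) = F s.
Proof. by rewrite plift_cls liftU scale1r. Qed.

Lemma plift_linear : linear (plift F).
Proof.
move=> a p q; rewrite -[p]pcls_repr -[q]pcls_repr -pcls_scale -pcls_add.
by rewrite !plift_cls fglift_linear.
Qed.

End Lift.
End Presentation.

Definition bilin (K : fieldType) (V W U : lmodType K) (f : V -> W -> U) :=
  (forall w, linear (f^~ w)) /\ (forall v, linear (f v)).

Definition multilin (K : fieldType) (V U : lmodType K) (F : seq V -> U) :=
  forall u v, linear (fun x => F (u ++ x :: v)).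

(* Tensor product of vector spaces, specified by its universal property; the
   value of tp_lift on functions that are not bilinear is irrelevant. *)
Record tensor_product (K : fieldType) (V W : lmodType K) := TensorProduct {
  tp_car : lmodType K;
  tp_pure : V -> W -> tp_car;
  tp_lift : forall U : lmodType K, (V -> W -> U) -> tp_car -> U;
  tp_bilin : bilin tp_pure;
  tp_span : forall t, span (fun u => exists v w, u = tp_pure v w) t;
  tp_lift_linear : forall (U : lmodType K) (f : V -> W -> U), bilin f -> linear (tp_lift f);
  tp_liftE : forall (U : lmodType K) (f : V -> W -> U) v w,
    bilin f -> tp_lift f (tp_pure v w) = f v w
}.

(* Tensor algebra (direct sum of the tensor powers), specified as the universal
   target of families of multilinear maps on the words of each length. *)
Record tensor_algebra (K : fieldType) (X : lmodType K) := TensorAlgebra {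
  ta_car : lmodType K;
  ta_word : seq X -> ta_car;
  ta_lift : forall U : lmodType K, (seq X -> U) -> ta_car -> U;
  ta_multilin : multilin ta_word;
  ta_span : forall t, span (fun u => exists w, u = ta_word w) t;
  ta_lift_linear : forall (U : lmodType K) (F : seq X -> U), multilin F -> linear (ta_lift F);
  ta_liftE : forall (U : lmodType K) (F : seq X -> U) w,
    multilin F -> ta_lift F (ta_word w) = F w
}.

Section TensorExists.
Variables (K : fieldType).

Lemma pgen_relE (S : choiceType) (rel : {freeg S / K} -> Prop) s (a : K) t u :
  rel (<< s >> - (a *: << t >> + << u >>)) ->
  pgen rel s = a *: pgen rel t + pgen rel u.
Proof.
move=> h; rewrite /pgen -pcls_scale -pcls_add; apply/pclsP.
exact: span_gen.
Qed.

Inductive tens_rel (V W : lmodType K) : {freeg (V * W)%type / K} -> Prop :=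
| tens_rell a v v' w :
    tens_rel (<< (a *: v + v', w) >> - (a *: << (v, w) >> + << (v', w) >>))
| tens_relr a v w w' :
    tens_rel (<< (v, a *: w + w') >> - (a *: << (v, w) >> + << (v, w') >>)).

Lemma tensor_product_exists (V W : lmodType K) : tensor_product V W.
Proof.
have R (U : lmodType K) (f : V -> W -> U) : bilin f ->
    forall r, tens_rel r -> fglift (fun p => f p.1 p.2) r = 0.
  case=> fl fr _ [a v v' w|a v w w']; rewrite raddfB raddfD /= fglift_scale !liftU !scale1r.
    by rewrite fl subrr.
  by rewrite fr subrr.
apply: (@TensorProduct _ _ _ (pres (@tens_rel V W)) (fun v w => pgen _ (v, w))
  (fun U f => plift (fun p => f p.1 p.2))).
- split=> [w a v v'|v a w w']; apply: pgen_relE.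
    exact: tens_rell.
  exact: tens_relr.
- elim/pgen_ind => [|a [v w] t ht]; first exact: span0.
  by apply: spanD => //; exists v, w.
- by move=> U f /R hf; apply: plift_linear.
- by move=> U f v w /R hf; rewrite [LHS]plift_gen.
Qed.

Inductive word_rel (X : lmodType K) : {freeg (seq X) / K} -> Prop :=
| word_relI a x y u v :
    word_rel (<< u ++ (a *: x + y) :: v >>
              - (a *: << u ++ x :: v >> + << u ++ y :: v >>)).

Lemma tensor_algebra_exists (X : lmodType K) : tensor_algebra X.
Proof.
have R (U : lmodType K) (F : seq X -> U) : multilin F ->
    forall r, word_rel r -> fglift F r = 0.
  move=> hF _ [a x y u v]; rewrite raddfB raddfD /= fglift_scale !liftU !scale1r.
  by rewrite hF subrr.
apply: (@TensorAlgebra _ _ (pres (@word_rel X)) (fun w => pgen _ w)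
  (fun U F => plift F)).
- by move=> u v a x y; apply: pgen_relE; exact: word_relI.
- elim/pgen_ind => [|a w t ht]; first exact: span0.
  by apply: spanD => //; exists w.
- by move=> U F /R hF; apply: plift_linear.
- by move=> U F w /R hF; rewrite [LHS]plift_gen.
Qed.

End TensorExists.

Section Tensor.
Variables (K : fieldType) (V W : lmodType K).

Definition tens : lmodType K := tp_car (tensor_product_exists V W).
Definition pure : V -> W -> tens := @tp_pure _ _ _ _.
Definition tlift (U : lmodType K) : (V -> W -> U) -> tens -> U := @tp_lift _ _ _ _ U.

Lemma pure_bilin : bilin pure. Proof. exact: tp_bilin. Qed.

Lemma tens_span (t : tens) : span (fun u => exists v w, u = pure v w) t.
Proof. exact: tp_span. Qed.

Lemma tlift_linear (U : lmodType K) (f : V -> W -> U) : bilin f -> linear (tlift f).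
Proof. exact: tp_lift_linear. Qed.

Lemma tlift_pure (U : lmodType K) (f : V -> W -> U) v w : bilin f ->
  tlift f (pure v w) = f v w.
Proof. exact: tp_liftE. Qed.

Lemma tens_ind (P : tens -> Prop) :
  P 0 -> (forall a v w t, P t -> P (a *: pure v w + t)) -> forall t, P t.
Proof.
move=> P0 PD t; elim: (tens_span t) => // a _ {}t [v [w ->]] _; exact: PD.
Qed.

End Tensor.

Section Words.
Variables (K : fieldType) (X : lmodType K).

Definition talg : lmodType K := ta_car (tensor_algebra_exists X).
Definition word : seq X -> talg := @ta_word _ _ _.
Definition wlift (U : lmodType K) : (seq X -> U) -> talg -> U := @ta_lift _ _ _ U.

Lemma word_multilin : multilin word. Proof. exact: ta_multilin. Qed.

Lemma talg_span (t : talg) : span (fun u => exists w, u = word w) t.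
Proof. exact: ta_span. Qed.

Lemma wlift_linear (U : lmodType K) (F : seq X -> U) : multilin F -> linear (wlift F).
Proof. exact: ta_lift_linear. Qed.

Lemma wlift_word (U : lmodType K) (F : seq X -> U) w : multilin F ->
  wlift F (word w) = F w.
Proof. exact: ta_liftE. Qed.

Lemma talg_ind (P : talg -> Prop) :
  P 0 -> (forall a w t, P t -> P (a *: word w + t)) -> forall t, P t.
Proof.
move=> P0 PD t; elim: (talg_span t) => // a _ {}t [w ->] _; exact: PD.
Qed.

End Words.

Lemma tlift_combf (K : fieldType) (V W U : lmodType K) (f g h : V -> W -> U) a t :
  bilin g -> bilin h -> (forall v w, f v w = a *: g v w + h v w) ->
  tlift f t = a *: tlift g t + tlift h t.
Proof.
move=> bg bh E; have bf : bilin f.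
  have [g1 g2] := bg; have [h1 h2] := bh.
  split=> [w k v v'|v k w w']; rewrite !E ?g1 ?h1 ?g2 ?h2.
    by rewrite !scalerDr addrACA !scalerA mulrC.
  by rewrite !scalerDr addrACA !scalerA mulrC.
elim/tens_ind: t => [|k v w t IH].
  have z0 (k : V -> W -> U) : bilin k -> tlift k 0 = 0.
    move=> /tlift_linear L; have := L (-1) 0 0.
    by rewrite scaler0 addr0 scaleN1r addNr.
  by rewrite !z0 // scaler0 addr0.
rewrite !tlift_linear // !tlift_pure // IH E !scalerDr addrACA !scalerA.
by rewrite mulrC.
Qed.

Section FinSum.
Variables (K : fieldType) (U : lmodType K).
Implicit Types F G : int -> U.

Definition fsupp F := exists2 s : seq int, uniq s & forall i, i \notin s -> F i = 0.

Lemma gsumE (s : seq int) F : uniq s -> (forall i, i \notin s -> F i = 0) ->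
  \sum_(i \in [set: int]) F i = \sum_(i <- s) F i.
Proof.
move=> us hF; rewrite [RHS]fsbig_seq //; apply/esym.
by apply: (fsbig_widen [set` s]%classic [set: int]%classic) => // i [_ /= /negP]; exact: hF.
Qed.

Lemma gsum1 d F : (forall i, i != d -> F i = 0) ->
  \sum_(i \in [set: int]) F i = F d.
Proof.
move=> hF; rewrite (@gsumE [:: d]) ?big_seq1 // => i.
by rewrite inE; exact: hF.
Qed.

Lemma fsupp2 F G : fsupp F -> fsupp G ->
  exists2 s : seq int, uniq s & forall i, i \notin s -> F i = 0 /\ G i = 0.
Proof.
case=> s us hs [t ut ht]; exists (undup (s ++ t)); first exact: undup_uniq.
move=> i; rewrite mem_undup mem_cat negb_or => /andP[si ti].
by split; [exact: hs|exact: ht].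
Qed.

Lemma gsum_linear a F G : fsupp F -> fsupp G ->
  \sum_(i \in [set: int]) (a *: F i + G i) =
  a *: (\sum_(i \in [set: int]) F i) + \sum_(i \in [set: int]) G i.
Proof.
move=> hF hG; have [s us hs] := fsupp2 hF hG.
rewrite !(@gsumE s) //; try by move=> i /hs[].
  by rewrite scaler_sumr -big_split.
by move=> i /hs[-> ->]; rewrite scaler0 addr0.
Qed.

End FinSum.

Lemma linear_gsum (K : fieldType) (U V : lmodType K) (f : {linear U -> V})
    (F : int -> U) : fsupp F ->
  f (\sum_(i \in [set: int]) F i) = \sum_(i \in [set: int]) f (F i).
Proof.
case=> s us hs; rewrite !(@gsumE _ _ s) //; first exact: linear_sum.
by move=> i /hs ->; rewrite linear0.
Qed.

(* A Z-graded vector space, as a vector space with an internal direct sum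
   decomposition: gcomp i is the projection onto the component of degree i, and
   every vector is the sum of finitely many of its components. *)
Record gvect (K : fieldType) := GVect {
  gcar :> lmodType K;
  gcomp : int -> {linear gcar -> gcar};
  gcompK : forall i j v, gcomp i (gcomp j v) = if i == j then gcomp j v else 0;
  gcompS : forall v, exists2 s : seq int, uniq s & v = \sum_(i <- s) gcomp i v
}.

Section Graded.
Variable K : fieldType.
Implicit Types V W : gvect K.

Definition homog V (i : int) (v : V) := gcomp V i v = v.

Definition has_degree V W (k : int) (f : V -> W) :=
  forall i v, homog i v -> homog (i + k) (f v).

Lemma gcompE V i d (v : V) : homog d v -> gcomp V i v = if i == d then v else 0.
Proof. by move=> h; rewrite -h gcompK h. Qed.

Lemma homog_comp V i (v : V) : homog i (gcomp V i v).
Proof. by rewrite /homog gcompK eqxx. Qed.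

Lemma fsupp_comp V (v : V) : fsupp (fun i => gcomp V i v).
Proof.
have [s us hs] := gcompS v; exists s => // i si.
rewrite {1}hs linear_sum big1_seq // => j /andP[_ sj]; rewrite gcompK.
by case: eqP => // ij; rewrite ij sj in si.
Qed.

Lemma gsum_comp V (v : V) : \sum_(i \in [set: int]) gcomp V i v = v.
Proof.
have [s us hs] := gcompS v; rewrite [RHS]hs; apply: gsumE => // i si.
rewrite {1}hs linear_sum big1_seq // => j /andP[_ sj]; rewrite gcompK.
by case: eqP => // ij; rewrite ij sj in si.
Qed.

Lemma homog_span V (v : V) : span (fun u => exists i, homog i u) v.
Proof.
have [s us ->] := gcompS v; apply: span_sum => i; apply: span_gen.
by exists i; exact: homog_comp.
Qed.

Section Build.
Variables (V : lmodType K) (comp : int -> {linear V -> V}) (G : V -> Prop).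
Hypothesis Ghom : forall u, G u ->
  exists d, forall n, comp n u = if n == d then u else 0.
Hypothesis Gspan : forall v, span G v.

Lemma build_K i j v : comp i (comp j v) = if i == j then comp j v else 0.
Proof.
elim: (Gspan v) => [|a u {}v /Ghom[d hd] _ IH].
  by rewrite !linear0 if_same.
rewrite !linearP IH !hd; case: (eqVneq j d) => [->|jd].
  by rewrite hd; case: ifP => // _; rewrite scaler0 addr0.
by rewrite linear0 !scaler0 !add0r.
Qed.

Lemma build_S v : exists2 s : seq int, uniq s & v = \sum_(i <- s) comp i v.
Proof.
suff [s us [hs0 hs]] : exists2 s : seq int, uniq s &
    (forall i, i \notin s -> comp i v = 0) /\ v = \sum_(i <- s) comp i v.
  by exists s.
elim: (Gspan v) => [|a u {}v /Ghom[d hd] _ [s us [hs0 hs]]].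
  by exists [::] => //; split => [i _|]; rewrite ?linear0 ?big_nil.
have out t : uniq t -> {subset s <= t} -> v = \sum_(i <- t) comp i v.
  move=> ut st; rewrite {1}hs [RHS](bigID (mem s)) /= [X in _ = _ + X]big1 ?addr0; last first.
    by move=> i; exact: hs0.
  rewrite -[in RHS]big_filter; apply: perm_big; apply: uniq_perm => //.
    exact: filter_uniq.
  move=> i; rewrite mem_filter /=; case: (boolP (i \in s)) => //= /st ->//.
have [t [ut dt st]] : exists t : seq int, [/\ uniq t, d \in t & {subset s <= t}].
  exists (undup (d :: s)); split; rewrite ?undup_uniq ?mem_undup ?mem_head //.
  by move=> i si; rewrite mem_undup inE si orbT.
exists t => //; split=> [i it|].
  rewrite linearP hd hs0 ?addr0; last by apply: contraNN it => /st.
  by case: eqP it => [->|_ _]; rewrite ?dt ?scaler0.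
under eq_bigr do rewrite linearP hd.
rewrite big_split /= -(out t) //; congr (_ + _).
rewrite (bigD1_seq d) //= eqxx big1 ?addr0 //.
by move=> i /negPf ->; rewrite scaler0.
Qed.

Definition build_gvect : gvect K := GVect build_K build_S.

End Build.

End Graded.

Notation "x ⊗ y" := (pure x y) (at level 40, left associativity) : ring_scope.

Section TensorLemmas.
Variables (K : fieldType) (V W : lmodType K).

Lemma pureDl a (v v' : V) (w : W) : (a *: v + v') ⊗ w = a *: (v ⊗ w) + v' ⊗ w.
Proof. by have [h _] := pure_bilin V W; exact: h. Qed.

Lemma pureDr a (v : V) (w w' : W) : v ⊗ (a *: w + w') = a *: (v ⊗ w) + v ⊗ w'.
Proof. by have [_ h] := pure_bilin V W; exact: h. Qed.

HB.instance Definition _ (v : V) :=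
  GRing.isLinear.Build K W (tens V W) *:%R (pure v) (fun a w w' => pureDr a v w w').

Lemma pure0l (w : W) : (0 : V) ⊗ w = 0.
Proof.
have := pureDl 0 0 0 w; rewrite scaler0 addr0 scale0r add0r => h.
by have := pureDl (-1) 0 0 w; rewrite scaler0 addr0 scaleN1r addNr.
Qed.

Lemma pure0r (v : V) : v ⊗ (0 : W) = 0.
Proof. exact: linear0. Qed.

Lemma pure_suml (I : Type) (r : seq I) (F : I -> V) (w : W) :
  (\sum_(i <- r) F i) ⊗ w = \sum_(i <- r) F i ⊗ w.
Proof.
elim: r => [|i r IH]; first by rewrite !big_nil pure0l.
by rewrite !big_cons -IH -[F i]scale1r pureDl !scale1r.
Qed.

Lemma pure_sumr (I : Type) (r : seq I) (F : I -> W) (v : V) :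
  v ⊗ (\sum_(i <- r) F i) = \sum_(i <- r) v ⊗ F i.
Proof. exact: linear_sum. Qed.

End TensorLemmas.

Section GradedTensor.
Variables (K : fieldType) (V W : gvect K).

Definition tcomp_pure (n : int) (v : V) (w : W) : tens V W :=
  \sum_(i \in [set: int]) gcomp V i v ⊗ gcomp W (n - i) w.

Definition tcomp n : tens V W -> tens V W := tlift (tcomp_pure n).

Lemma fsupp_pure n (v : V) (w : W) :
  fsupp (fun i => gcomp V i v ⊗ gcomp W (n - i) w).
Proof.
have [s us hs] := fsupp_comp v; exists s => // i /hs ->.
by rewrite pure0l.
Qed.

Lemma tcomp_bilin n : bilin (tcomp_pure n).
Proof.
split=> [w a v v'|v a w w']; rewrite /tcomp_pure -gsum_linear; try exact: fsupp_pure.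
  by apply: eq_fsbigr => i _; rewrite linearP pureDl.
by apply: eq_fsbigr => i _; rewrite linearP pureDr.
Qed.

HB.instance Definition _ n := GRing.isLinear.Build K (tens V W) (tens V W) *:%R
  (tcomp n) (tlift_linear (tcomp_bilin n)).

Lemma tcomp_homog n i j (v : V) (w : W) : homog i v -> homog j w ->
  tcomp n (v ⊗ w) = if n == i + j then v ⊗ w else 0.
Proof.
move=> hv hw; rewrite /tcomp tlift_pure; last exact: tcomp_bilin.
rewrite /tcomp_pure (@gsum1 _ _ i); last first.
  by move=> k ki; rewrite (gcompE _ hv) (negPf ki) pure0l.
rewrite hv (gcompE _ hw) subr_eq addrC; case: eqP => // _.
by rewrite pure0r.
Qed.

Lemma gtens_gen (t : tens V W) :
  (exists v w, [/\ exists i, homog i v, exists j, homog j w & t = v ⊗ w]) ->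
  exists d, forall n, tcomp n t = if n == d then t else 0.
Proof.
by case=> v [w [[i hv] [j hw] ->]]; exists (i + j) => n; exact: tcomp_homog.
Qed.

Lemma gtens_span (t : tens V W) :
  span (fun t => exists v w, [/\ exists i, homog i v, exists j, homog j w & t = v ⊗ w]) t.
Proof.
elim/tens_ind: t => [|a v w t ht]; first exact: span0.
apply: span_add => //; apply: span_scale.
have [s us ->] := gcompS v; have [s' us' ->] := gcompS w.
rewrite pure_suml; apply: span_sum => i; rewrite pure_sumr; apply: span_sum => j.
apply: span_gen; exists (gcomp V i v), (gcomp W j w); split=> //.
  by exists i; exact: homog_comp.
by exists j; exact: homog_comp.
Qed.

Canonical gtens : gvect K := @build_gvect K (tens V W) tcomp _ gtens_gen gtens_span.

End GradedTensor.

Section GradedTensorAlgebra.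
Variables (K : fieldType) (X : gvect K).

Definition tcons_word (x : X) (w : seq X) : talg X := word (x :: w).
Definition tcons (x : X) : talg X -> talg X := wlift (tcons_word x).

Lemma tcons_multilin x : multilin (tcons_word x).
Proof. by move=> u v a y z; exact: (word_multilin (x :: u) v). Qed.

HB.instance Definition _ x := GRing.isLinear.Build K (talg X) (talg X) *:%R
  (tcons x) (wlift_linear (tcons_multilin x)).

Lemma tcons_wordE x w : tcons x (word w) = word (x :: w).
Proof. by rewrite /tcons wlift_word //; exact: tcons_multilin. Qed.

Lemma tconsDl a x y t : tcons (a *: x + y) t = a *: tcons x t + tcons y t.
Proof.
elim/talg_ind: t => [|b w t IH]; first by rewrite !linear0 ?scaler0 ?addr0.
have E z : tcons z (b *: word w + t) = b *: word (z :: w) + tcons z t.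
  by rewrite linearP /= tcons_wordE.
rewrite !E IH (word_multilin [::] w) /= !scalerDr !scalerA [b * a]mulrC.
by rewrite -!addrA; congr (_ + _); rewrite addrCA.
Qed.

Lemma tcons0l t : tcons 0 t = 0.
Proof. by have := tconsDl (-1) 0 0 t; rewrite scaler0 addr0 scaleN1r addNr. Qed.

Lemma tcons_suml (I : Type) (r : seq I) (F : I -> X) t :
  tcons (\sum_(i <- r) F i) t = \sum_(i <- r) tcons (F i) t.
Proof.
elim: r => [|i r IH]; first by rewrite !big_nil tcons0l.
by rewrite !big_cons -IH -[F i]scale1r tconsDl !scale1r.
Qed.

Fixpoint wcomp_word (n : int) (w : seq X) : talg X :=
  if w is x :: w' then
    \sum_(i \in [set: int]) tcons (gcomp X i x) (wcomp_word (n - i) w')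
  else if n == 0 then word [::] else 0.

Definition wcomp n : talg X -> talg X := wlift (wcomp_word n).

Lemma fsupp_tcons (x : X) (F : int -> talg X) :
  fsupp (fun i => tcons (gcomp X i x) (F i)).
Proof.
have [s us hs] := fsupp_comp x; exists s => // i /hs ->.
by rewrite tcons0l.
Qed.

Lemma wcomp_multilin n : multilin (wcomp_word n).
Proof.
move=> u v a x y; elim: u n => [|z u IH] n; rewrite -gsum_linear /=;
  try exact: fsupp_tcons.
  by apply: eq_fsbigr => i _; rewrite linearP tconsDl.
by apply: eq_fsbigr => i _; rewrite IH linearP.
Qed.

HB.instance Definition _ n := GRing.isLinear.Build K (talg X) (talg X) *:%R
  (wcomp n) (wlift_linear (wcomp_multilin n)).

Inductive hword : int -> seq X -> Prop :=
| hword_nil : hword 0 [::]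
| hword_cons i d x w : homog i x -> hword d w -> hword (i + d) (x :: w).

Lemma wcomp_hword n d w : hword d w ->
  wcomp n (word w) = if n == d then word w else 0.
Proof.
move=> hw; rewrite /wcomp wlift_word; last exact: wcomp_multilin.
elim: hw n => [|i {}d x {}w hx _ IH] n //=.
rewrite (@gsum1 _ _ i); last first.
  by move=> k ki; rewrite (gcompE _ hx) (negPf ki) tcons0l.
rewrite hx IH subr_eq addrC; case: eqP => // _; last exact: linear0.
by rewrite tcons_wordE.
Qed.

Lemma gtalg_gen (t : talg X) : (exists d w, hword d w /\ t = word w) ->
  exists d, forall n, wcomp n t = if n == d then t else 0.
Proof. by case=> d [w [hw ->]]; exists d => n; exact: wcomp_hword. Qed.

Lemma gtalg_span (t : talg X) : span (fun t => exists d w, hword d w /\ t = word w) t.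
Proof.
elim/talg_ind: t => [|a w t ht]; first exact: span0.
apply: span_add => //; apply: span_scale => {a t ht}.
elim: w => [|x w IH].
  by apply: span_gen; exists 0, [::]; split=> //; exact: hword_nil.
rewrite -tcons_wordE.
elim: IH => [|a u t [d [v [hv ->]]] _ IH]; first by rewrite linear0; exact: span0.
rewrite linearP; apply: span_add => //; apply: span_scale => /=.
have [s us ->] := gcompS x; rewrite tcons_suml; apply: span_sum => i.
rewrite tcons_wordE; apply: span_gen; exists (i + d), (gcomp X i x :: v); split=> //.
by apply: hword_cons => //; exact: homog_comp.
Qed.

Canonical gtalg : gvect K := @build_gvect K (talg X) wcomp _ gtalg_gen gtalg_span.

End GradedTensorAlgebra.

Section TensorMaps.
Variable K : fieldType.

Lemma eq_tlift (V W U : lmodType K) (f g : V -> W -> U) t :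
  (forall v w, f v w = g v w) -> tlift f t = tlift g t.
Proof. by move=> E; congr (tlift _ t); apply/funext => v; apply/funext => w. Qed.

Definition tmap (V V' W W' : lmodType K) (f : V -> V') (g : W -> W') :
  tens V W -> tens V' W' := tlift (fun v w => f v ⊗ g w).

Section TMap.
Variables (V V' W W' : lmodType K) (f : {linear V -> V'}) (g : {linear W -> W'}).

Lemma tmap_bilin : bilin (fun v w => f v ⊗ g w).
Proof. by split=> [w a v v'|v a w w']; rewrite linearP ?pureDl ?pureDr. Qed.

Lemma tmapE v w : tmap f g (v ⊗ w) = f v ⊗ g w.
Proof. by rewrite /tmap tlift_pure //; exact: tmap_bilin. Qed.

Lemma tmap_linear : linear (tmap f g).
Proof. by apply: tlift_linear; exact: tmap_bilin. Qed.
HB.instance Definition _ :=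
  GRing.isLinear.Build K (tens V W) (tens V' W') *:%R (tmap f g) tmap_linear.

Lemma tmap0 : tmap f g 0 = 0.
Proof. exact: linear0. Qed.

End TMap.

Lemma tens_linear_eq (V W U : lmodType K) (f g : {linear tens V W -> U}) :
  (forall v w, f (v ⊗ w) = g (v ⊗ w)) -> f =1 g.
Proof.
by move=> h t; apply: span_linear_eq (tens_span t) => _ [v [w ->]].
Qed.

Lemma tmap_id (V W : lmodType K) (t : tens V W) : tmap idfun idfun t = t.
Proof.
rewrite -[RHS]/(idfun t); apply: (@tens_linear_eq _ _ _ (tmap idfun idfun) idfun) => v w.
by rewrite /= tmapE.
Qed.

Lemma tmap_comp (V V' V'' W W' W'' : lmodType K)
  (f : {linear V -> V'}) (f' : {linear V' -> V''})
  (g : {linear W -> W'}) (g' : {linear W' -> W''}) (t : tens V W) :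
  tmap (f' \o f) (g' \o g) t = tmap f' g' (tmap f g t).
Proof.
rewrite -[RHS]/((tmap f' g' \o tmap f g) t).
apply: (@tens_linear_eq _ _ _ (tmap (f' \o f) (g' \o g)) (tmap f' g' \o tmap f g)).
by move=> v w; rewrite /= !tmapE.
Qed.

Definition tassoc (U V W : lmodType K) : tens (tens U V) W -> tens U (tens V W) :=
  tlift (fun s w => tlift (fun u v => u ⊗ (v ⊗ w)) s).

Section TAssoc.
Variables U V W : lmodType K.

Lemma tassoc_bilin1 (w : W) : bilin (fun (u : U) (v : V) => u ⊗ (v ⊗ w)).
Proof. by split=> [v a u u'|u a v v']; rewrite ?pureDl ?pureDr. Qed.

Lemma tassoc_bilin :
  bilin (fun (s : tens U V) (w : W) => tlift (fun u v => u ⊗ (v ⊗ w)) s).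
Proof.
split=> [w|s a w w']; first by apply: tlift_linear; exact: tassoc_bilin1.
by apply: tlift_combf => [||u v]; [exact: tassoc_bilin1|exact: tassoc_bilin1|rewrite !pureDr].
Qed.

Lemma tassocE (u : U) (v : V) (w : W) : tassoc ((u ⊗ v) ⊗ w) = u ⊗ (v ⊗ w).
Proof.
by rewrite /tassoc !tlift_pure //; [exact: tassoc_bilin1|exact: tassoc_bilin].
Qed.

HB.instance Definition _ := GRing.isLinear.Build K (tens (tens U V) W)
  (tens U (tens V W)) *:%R (@tassoc U V W) (tlift_linear tassoc_bilin).

Lemma tassoc_linear : linear (@tassoc U V W).
Proof. exact: tlift_linear tassoc_bilin. Qed.

Lemma tassoc0 : @tassoc U V W 0 = 0.
Proof. exact: linear0. Qed.

End TAssoc.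

(* Koszul sign operator: v |-> (-1)^(k|v|) v on homogeneous v. *)
Definition koszul (V : gvect K) (k : int) (v : V) : V :=
  \sum_(i \in [set: int]) (-1) ^ (k * i) *: gcomp V i v.

Lemma koszulE (V : gvect K) k i (v : V) : homog i v ->
  koszul k v = (-1) ^ (k * i) *: v.
Proof.
move=> hv; rewrite /koszul (@gsum1 _ _ i) ?hv // => j ji.
by rewrite (gcompE _ hv) (negPf ji) scaler0.
Qed.

Lemma fsupp_koszul (V : gvect K) k (v : V) :
  fsupp (fun i => (-1) ^ (k * i) *: gcomp V i v).
Proof.
have [s us hs] := fsupp_comp v; exists s => // i /hs ->.
by rewrite scaler0.
Qed.

Lemma koszul_linear (V : gvect K) k : linear (@koszul V k).
Proof.
move=> a u v; rewrite -gsum_linear; try exact: fsupp_koszul.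
by apply: eq_fsbigr => i _; rewrite linearP scalerDr !scalerA mulrC.
Qed.
HB.instance Definition _ (V : gvect K) k :=
  GRing.isLinear.Build K V V *:%R (@koszul V k) (koszul_linear k).

(* Symmetry: v ⊗ w |-> (-1)^(|v||w|) w ⊗ v on homogeneous v, w. *)
Definition tswap_pure (V W : gvect K) (v : V) (w : W) : tens W V :=
  \sum_(i \in [set: int]) koszul i w ⊗ gcomp V i v.

Definition tswap (V W : gvect K) : tens V W -> tens W V := tlift (@tswap_pure V W).

Section Swap.
Variables V W : gvect K.

Lemma fsupp_swap (v : V) (w : W) : fsupp (fun i => koszul i w ⊗ gcomp V i v).
Proof.
have [s us hs] := fsupp_comp v; exists s => // i /hs ->.
by rewrite pure0r.
Qed.

Lemma tswap_bilin : bilin (@tswap_pure V W).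
Proof.
split=> [w a v v'|v a w w']; rewrite /tswap_pure -gsum_linear; try exact: fsupp_swap.
  by apply: eq_fsbigr => i _; rewrite linearP pureDr.
by apply: eq_fsbigr => i _; rewrite linearP pureDl.
Qed.

Lemma tswap_linear : linear (@tswap V W).
Proof. exact: tlift_linear tswap_bilin. Qed.
HB.instance Definition _ := GRing.isLinear.Build K (tens V W)
  (tens W V) *:%R (@tswap V W) tswap_linear.

Lemma tswapE i j (v : V) (w : W) : homog i v -> homog j w ->
  tswap (v ⊗ w) = (-1) ^ (i * j) *: (w ⊗ v).
Proof.
move=> hv hw; rewrite /tswap tlift_pure; last exact: tswap_bilin.
rewrite /tswap_pure (@gsum1 _ _ i) => [|k ki].
  rewrite hv (koszulE _ hw); have := pureDl ((-1) ^ (i * j)) w 0 v.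
  by rewrite pure0l !addr0.
by rewrite (gcompE _ hv) (negPf ki) pure0r.
Qed.

End Swap.

(* The map id ⊗ tswap ⊗ id : (A ⊗ B) ⊗ (C ⊗ D) -> (A ⊗ C) ⊗ (B ⊗ D). *)
Definition tmid (A B C D : gvect K) (a : A) (d : D) :
    tens C B -> tens (tens A C) (tens B D) :=
  tlift (fun c b => (a ⊗ c) ⊗ (b ⊗ d)).

Definition tinter_pure (A B C D : gvect K) (s : tens A B) (t : tens C D) :
    tens (tens A C) (tens B D) :=
  tlift (fun a b => tlift (fun c d => tmid a d (tswap (b ⊗ c))) t) s.

Definition tinter (A B C D : gvect K) :
    tens (tens A B) (tens C D) -> tens (tens A C) (tens B D) :=
  tlift (@tinter_pure A B C D).

Section Interchange.
Variables A B C D : gvect K.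
Implicit Types (a : A) (b : B) (c : C) (d : D).

Lemma tmid_bilin a d : bilin (fun (c : C) (b : B) => (a ⊗ c) ⊗ (b ⊗ d)).
Proof. by split=> [b k c c'|c k b b']; rewrite ?(pureDl, pureDr). Qed.

Lemma tmid_linear a d : linear (@tmid A B C D a d).
Proof. exact: tlift_linear (tmid_bilin a d). Qed.
HB.instance Definition _ a d := GRing.isLinear.Build K (tens C B)
  (tens (tens A C) (tens B D)) *:%R (@tmid A B C D a d) (tmid_linear a d).

Lemma tinter_bilin2 a b : bilin (fun c d => tmid a d (tswap (b ⊗ c))).
Proof.
split=> [d k c c'|c k d d']; first by rewrite pureDr tswap_linear tmid_linear.
by apply: tlift_combf => [||c' b']; [exact: tmid_bilin|exact: tmid_bilin|rewrite !pureDr].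
Qed.

Lemma tinter_bilin1 (t : tens C D) :
  bilin (fun a b => tlift (fun c d => tmid a d (tswap (b ⊗ c))) t).
Proof.
split=> [b k a a'|a k b b']; apply: tlift_combf => [||c d]; try exact: tinter_bilin2.
  by apply: tlift_combf => [||c' b']; [exact: tmid_bilin|exact: tmid_bilin|rewrite !pureDl].
by rewrite pureDl tswap_linear tmid_linear.
Qed.

Lemma tinter_bilin : bilin (@tinter_pure A B C D).
Proof.
split=> [t|s k t t']; first by apply: tlift_linear; exact: tinter_bilin1.
by apply: tlift_combf => [||a b]; try exact: tinter_bilin1; apply: tlift_linear; exact: tinter_bilin2.
Qed.

HB.instance Definition _ := GRing.isLinear.Build K (tens (tens A B) (tens C D))
  (tens (tens A C) (tens B D)) *:%R (@tinter A B C D) (tlift_linear tinter_bilin).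

Lemma tinterE i j a b c d : homog i b -> homog j c ->
  tinter ((a ⊗ b) ⊗ (c ⊗ d)) = (-1) ^ (i * j) *: ((a ⊗ c) ⊗ (b ⊗ d)).
Proof.
move=> hb hc; rewrite /tinter tlift_pure; last exact: tinter_bilin.
rewrite /tinter_pure tlift_pure; last exact: tinter_bilin1.
rewrite tlift_pure; last exact: tinter_bilin2.
rewrite (tswapE hb hc) linearZ /=; congr (_ *: _).
by rewrite /tmid tlift_pure //; exact: tmid_bilin.
Qed.

End Interchange.

(* d ⊗ id + id ⊗ d for d of degree -1; the second summand carries the Koszul
   sign (-1)^(|d||a|) on a ⊗ b. *)
Definition tder (V : gvect K) (d : V -> V) (t : tens V V) : tens V V :=
  tmap d idfun t + tmap (@koszul V (-1)) d t.

End TensorMaps.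

Arguments koszul {K} V k v.

Record ucoalg (K : fieldType) := UCoalg {
  uc_gvect :> gvect K;
  Delta : {linear uc_gvect -> tens uc_gvect uc_gvect};
  eps : {linear uc_gvect -> K^o};
  uone : uc_gvect;
  Delta_degree : has_degree 0 Delta;
  eps_degree : forall i v, homog i v -> i != 0 -> eps v = 0;
  uone_degree : homog 0 uone;
  coassoc : forall x,
    tassoc (tmap Delta idfun (Delta x)) = tmap idfun Delta (Delta x);
  counitl : forall x, tlift (fun a b => eps a *: b) (Delta x) = x;
  counitr : forall x, tlift (fun a b => eps b *: a) (Delta x) = x;
  Delta_one : Delta uone = uone ⊗ uone;
  eps_one : eps uone = 1
}.
Arguments Delta {K u}.
Arguments eps {K u}.
Arguments uone {K u}.

Section TensorCoalgebra.
Variables (K : fieldType) (X : gvect K).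
Local Notation T := (talg X).
Local Notation one := (word [::] : T).

Definition deconc_word (w : seq X) : tens T T :=
  \sum_(i < (size w).+1) word (take i w) ⊗ word (drop i w).
Definition deconc : T -> tens T T := wlift deconc_word.

Definition wcounit_word (w : seq X) : K^o := if w is [::] then 1 else 0.
Definition wcounit : T -> K^o := wlift wcounit_word.

Definition wproj1_word (w : seq X) : X := if w is [:: x] then x else 0.
Definition wproj1 : T -> X := wlift wproj1_word.

Lemma deconc_word_cons x w :
  deconc_word (x :: w) =
  one ⊗ word (x :: w) + tmap (tcons x) idfun (deconc_word w).
Proof.
rewrite /deconc_word big_ord_recl /=; congr (_ + _).
by rewrite linear_sum; apply: eq_bigr => i _; rewrite /= tmapE /= tcons_wordE.
Qed.

Lemma deconc_multilin : multilin deconc_word.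
Proof.
move=> u v a x y; elim: u => [|z u IH] /=; rewrite !deconc_word_cons.
  rewrite (word_multilin [::] v) pureDr.
  have -> : tmap (tcons (a *: x + y)) idfun (deconc_word v) =
      a *: tmap (tcons x) idfun (deconc_word v) + tmap (tcons y) idfun (deconc_word v).
    by apply: tlift_combf => [||s t]; try exact: tmap_bilin; rewrite tconsDl pureDl.
  by rewrite scalerDr addrACA.
rewrite (word_multilin (z :: u) v) pureDr IH tmap_linear.
by rewrite scalerDr addrACA.
Qed.

Lemma deconc_linear : linear deconc.
Proof. exact: wlift_linear deconc_multilin. Qed.
HB.instance Definition _ := GRing.isLinear.Build K T (tens T T) *:%R deconc deconc_linear.

Lemma deconc0 : deconc 0 = 0.
Proof. exact: linear0. Qed.

Lemma tcons_linear (x : X) : linear (tcons x).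
Proof. exact: linearP. Qed.

Lemma tcons0 (x : X) : tcons x 0 = 0.
Proof. exact: linear0. Qed.

Lemma deconcE w : deconc (word w) = deconc_word w.
Proof. by rewrite /deconc wlift_word //; exact: deconc_multilin. Qed.

Lemma wcounit_multilin : multilin wcounit_word.
Proof. by case=> [|z u] v a x y /=; rewrite scaler0 addr0. Qed.
Lemma wcounit_linear : linear wcounit.
Proof. exact: wlift_linear wcounit_multilin. Qed.
HB.instance Definition _ := GRing.isLinear.Build K T K^o *:%R wcounit wcounit_linear.
Lemma wcounitE w : wcounit (word w) = wcounit_word w.
Proof. by rewrite /wcounit wlift_word //; exact: wcounit_multilin. Qed.

Lemma wproj1_multilin : multilin wproj1_word.
Proof.
by case=> [|z [|z' u]] [|y' v] a x y //=; rewrite scaler0 addr0.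
Qed.
Lemma wproj1_linear : linear wproj1.
Proof. exact: wlift_linear wproj1_multilin. Qed.
HB.instance Definition _ := GRing.isLinear.Build K T X *:%R wproj1 wproj1_linear.
Lemma wproj1E w : wproj1 (word w) = wproj1_word w.
Proof. by rewrite /wproj1 wlift_word //; exact: wproj1_multilin. Qed.

Lemma hword_split d (w : seq X) i : hword d w ->
  exists d1 d2, [/\ hword d1 (take i w), hword d2 (drop i w) & d = d1 + d2].
Proof.
move=> hw; elim: hw i => [|j {}d x {}w hx hw IH] i.
  by exists 0, 0; split; [exact: hword_nil|exact: hword_nil|rewrite addr0].
case: i => [|i] /=.
  exists 0, (j + d); split; [exact: hword_nil|exact: hword_cons|by rewrite add0r].
have [d1 [d2 [h1 h2 ->]]] := IH i; exists (j + d1), d2; split => //.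
  exact: hword_cons.
by rewrite addrA.
Qed.

Lemma homog_hword d (w : seq X) : hword d w -> homog d (word w : gtalg X).
Proof. by move=> hw; rewrite /homog /= (wcomp_hword _ hw) eqxx. Qed.

Lemma homog_pure (V W : gvect K) i j (v : V) (w : W) :
  homog i v -> homog j w -> homog (i + j) (v ⊗ w : gtens V W).
Proof. by move=> hv hw; rewrite /homog /= (tcomp_homog _ hv hw) eqxx. Qed.

Lemma homog_deconc d (w : seq X) : hword d w -> homog d (deconc (word w) : gtens (gtalg X) (gtalg X)).
Proof.
move=> hw; rewrite deconcE /homog /deconc_word linear_sum; apply: eq_bigr => i _.
have [d1 [d2 [/homog_hword h1 /homog_hword h2 ->]]] := hword_split i hw.
exact: homog_pure.
Qed.

Lemma deconc_comp n (t : gtalg X) :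
  gcomp (gtens (gtalg X) (gtalg X)) n (deconc t) = deconc (gcomp (gtalg X) n t).
Proof.
apply: (@span_linear_eq _ _ _ _ (gcomp (gtens (gtalg X) (gtalg X)) n \o deconc)
  (deconc \o gcomp (gtalg X) n) _ t (gtalg_span t)) => u [d [w [hw ->]]].
rewrite [LHS](gcompE _ (homog_deconc hw)).
rewrite [RHS](congr1 deconc (gcompE _ (homog_hword hw))).
by case: ifP => // _; rewrite linear0.
Qed.

Fact deconc_degree :
  has_degree 0 (deconc : gtalg X -> gtens (gtalg X) (gtalg X)).
Proof. by move=> i t ht; rewrite /homog addr0 deconc_comp ht. Qed.

Fact wcounit_degree i (t : gtalg X) : homog i t -> i != 0 -> wcounit t = 0.
Proof.
move=> <- i0; apply: (@span_linear_eq _ _ _ _ (wcounit \o gcomp (gtalg X) i)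
  (GRing.null_fun K^o) _ t (gtalg_span t)) => u [d [w [hw ->]]].
rewrite [LHS](congr1 wcounit (gcompE _ (homog_hword hw))).
case: eqP => [id|_]; last exact: linear0.
rewrite wcounitE; case: w hw => // h; exfalso; move: i0; rewrite id.
by inversion h.
Qed.

Lemma deconc_tcons x t :
  deconc (tcons x t) = one ⊗ tcons x t + tmap (tcons x) idfun (deconc t).
Proof.
elim/talg_ind: t => [|a w t IH]; first by rewrite tcons0 deconc0 tmap0 pure0r addr0.
rewrite tcons_linear !deconc_linear IH pureDr tmap_linear.
by rewrite tcons_wordE !deconcE deconc_word_cons !scalerDr addrACA.
Qed.

Lemma tassoc_tmapl (U V W U' : lmodType K) (f : {linear U -> U'}) (s : tens U V) (w : W) :
  tassoc (tmap f idfun s ⊗ w) = tmap f idfun (tassoc (s ⊗ w)).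
Proof.
elim/tens_ind: s => [|a u v s IH].
  by rewrite tmap0 !pure0l !tassoc0 tmap0.
rewrite tmap_linear.
rewrite tmapE.
rewrite !pureDl.
rewrite !tassoc_linear. rewrite IH.
rewrite tmap_linear. rewrite !tassocE. by rewrite tmapE.
Qed.

Lemma coassoc_tcons x (D : tens T T) :
  tassoc (tmap deconc idfun (tmap (tcons x) idfun D)) =
  one ⊗ tmap (tcons x) idfun D + tmap (tcons x) idfun (tassoc (tmap deconc idfun D)).
Proof.
elim/tens_ind: D => [|a u v D IH].
  by rewrite !tmap0 tassoc0 tmap0 pure0r addr0.
rewrite !tmap_linear !tassoc_linear IH pureDr tmap_linear !tmapE /=.
rewrite deconc_tcons -[one ⊗ _]scale1r pureDl tassoc_linear scale1r tassocE tassoc_tmapl.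
by rewrite !scalerDr addrACA.
Qed.

Fact deconc_coassoc t :
  tassoc (tmap deconc idfun (deconc t)) = tmap idfun deconc (deconc t).
Proof.
elim/talg_ind: t => [|a w t IH].
  by rewrite deconc0 !tmap0 tassoc0.
rewrite deconc_linear !tmap_linear tassoc_linear IH; congr (_ *: _ + _) => {a t IH}.
elim: w => [|x w IH].
  by rewrite deconcE /deconc_word big_ord1 /= !tmapE /= deconcE /deconc_word big_ord1 /= tassocE.
rewrite -tcons_wordE deconc_tcons -[one ⊗ _]scale1r !tmap_linear tassoc_linear !scale1r.
rewrite coassoc_tcons IH !tmapE /= deconc_tcons.
rewrite [deconc one]deconcE /deconc_word big_ord1 /= tassocE addrA; congr (_ + _).
  by rewrite -[one ⊗ tcons x _]scale1r pureDr !scale1r.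
by rewrite -!tmap_comp.
Qed.

Lemma counitl_bilin (C : lmodType K) (e : {linear C -> K^o}) :
  bilin (fun a b : C => e a *: b).
Proof.
split=> [b k a a'|a k b b']; first by rewrite linearP scalerDl scalerA.
by rewrite scalerDr !scalerA mulrC.
Qed.

Lemma counitr_bilin (C : lmodType K) (e : {linear C -> K^o}) :
  bilin (fun a b : C => e b *: a).
Proof.
split=> [b k a a'|a k b b']; last by rewrite linearP scalerDl scalerA.
by rewrite scalerDr !scalerA mulrC.
Qed.

Fact deconc_counitl t : tlift (fun a b => wcounit a *: b) (deconc t) = t.
Proof.
have L := tlift_linear (counitl_bilin wcounit).
have E := fun a b => @tlift_pure _ _ _ _ _ a b (counitl_bilin wcounit).
have L0 : tlift (fun a b => wcounit a *: b) (0 : tens T T) = 0.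
  by have := L (-1) 0 0; rewrite scaler0 addr0 scaleN1r addNr.
elim/talg_ind: t => [|a w t IH]; first by rewrite deconc0.
rewrite deconc_linear L IH deconcE; congr (_ *: _ + _) => {a t IH}.
rewrite /deconc_word big_ord_recl -[_ ⊗ _]scale1r L E /= take0 drop0.
rewrite [X in _ *: (X *: _) + _]wcounitE /= !scale1r -[RHS]addr0; congr (_ + _).
elim/big_rec: _ => [|i s _ IH]; first exact: L0.
rewrite -[_ ⊗ _]scale1r L IH E addr0 [X in _ *: (X *: _)]wcounitE.
by case: w i => [[]|x w i] //=; rewrite scale0r scaler0.
Qed.

Fact deconc_counitr t : tlift (fun a b => wcounit b *: a) (deconc t) = t.
Proof.
have L := tlift_linear (counitr_bilin wcounit).
have E := fun a b => @tlift_pure _ _ _ _ _ a b (counitr_bilin wcounit).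
have L0 : tlift (fun a b => wcounit b *: a) (0 : tens T T) = 0.
  by have := L (-1) 0 0; rewrite scaler0 addr0 scaleN1r addNr.
elim/talg_ind: t => [|a w t IH]; first by rewrite deconc0.
rewrite deconc_linear L IH deconcE; congr (_ *: _ + _) => {a t IH}.
rewrite /deconc_word big_ord_recr /= addrC -[_ ⊗ _]scale1r L E take_size drop_size.
rewrite [X in _ *: (X *: _) + _]wcounitE /= !scale1r -[RHS]addr0; congr (_ + _).
elim/big_rec: _ => [|i s _ IH]; first exact: L0.
rewrite -[_ ⊗ _]scale1r L IH E addr0 [X in _ *: (X *: _)]wcounitE.
have : size (drop i w) != 0%N by rewrite size_drop subn_eq0 -ltnNge.
by case: (drop i w) => //= x v _; rewrite scale0r scaler0.
Qed.

Fact deconc_one : deconc one = one ⊗ one.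
Proof. by rewrite deconcE /deconc_word big_ord1. Qed.

Fact wcounit_one : wcounit one = 1.
Proof. by rewrite wcounitE. Qed.

Definition tcoalg : ucoalg K :=
  @UCoalg K (gtalg X) deconc wcounit one deconc_degree wcounit_degree
    (homog_hword (hword_nil X)) deconc_coassoc deconc_counitl deconc_counitr
    deconc_one wcounit_one.

End TensorCoalgebra.

Section Structures.
Variable K : fieldType.

Definition assoc_unital (V : lmodType K) (m : tens V V -> V) (e : V) : Prop :=
  [/\ forall a b c, m (m (a ⊗ b) ⊗ c) = m (a ⊗ m (b ⊗ c)),
      forall a, m (e ⊗ a) = a & forall a, m (a ⊗ e) = a].

(* Comultiplication and counit of the tensor product coalgebra C ⊗ C. *)
Definition Delta2 (C : ucoalg K) (t : tens C C) : tens (tens C C) (tens C C) :=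
  @tinter K C C C C (tmap Delta Delta t).
Definition eps2 (C : ucoalg K) : tens C C -> K := tlift (fun a b : C => (eps a * eps b : K^o)).

Record dg_bialgebra (C : ucoalg K) (m : tens C C -> C) (d : C -> C) : Prop := DgBialgebra {
  dgb_mul_degree : has_degree 0 m;
  dgb_mul_assoc : assoc_unital m uone;
  dgb_mul_Delta : forall t, Delta (m t) = tmap m m (Delta2 t);
  dgb_mul_eps : forall t, eps (m t) = eps2 t;
  dgb_d_degree : has_degree (-1) d;
  dgb_d_d : forall x, d (d x) = 0;
  dgb_d_one : d uone = 0;
  dgb_derivation : forall t, d (m t) = m (@tder K C d t);
  dgb_coderivation : forall x, Delta (d x) = @tder K C d (Delta x)
}.

Definition unital_infinitesimal (C : ucoalg K) (m : tens C C -> C) : Prop :=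
  assoc_unital m uone /\
  forall x y, Delta (m (x ⊗ y)) =
    tlift (fun x1 x2 => x1 ⊗ m (x2 ⊗ y)) (Delta x)
    + tlift (fun y1 y2 => m (x ⊗ y1) ⊗ y2) (Delta y) - x ⊗ y.

Record binfty := Binfty {
  bi_gvect :> gvect K;
  bi_mu : {linear tens (tcoalg bi_gvect) (tcoalg bi_gvect) -> tcoalg bi_gvect};
  bi_d : {linear tcoalg bi_gvect -> tcoalg bi_gvect};
  bi_axioms : dg_bialgebra bi_mu bi_d
}.

(* The structure maps m_n and m_{i,j}, as functions of the tensor factors. *)
Definition bi_m (A : binfty) n (t : n.-tuple A) : A :=
  wproj1 (bi_d A (word t)).
Definition bi_mm (A : binfty) i j (s : i.-tuple A) (t : j.-tuple A) : A :=
  wproj1 (bi_mu A (word s ⊗ word t)).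

Definition is_binfty_hom (A B : binfty) (f : A -> B) : Prop :=
  [/\ has_degree 0 f,
      forall n (t : n.-tuple A), (0 < n)%N ->
        f (bi_m t) = bi_m (map_tuple f t)
    & forall i j (s : i.-tuple A) (t : j.-tuple A), (0 < i)%N -> (0 < j)%N ->
        f (bi_mm s t) = bi_mm (map_tuple f s) (map_tuple f t)].

Record biass := Biass {
  ba_coalg :> ucoalg K;
  ba_d : {linear ba_coalg -> ba_coalg};
  ba_bul : {linear tens ba_coalg ba_coalg -> ba_coalg};
  ba_odot : {linear tens ba_coalg ba_coalg -> ba_coalg};
  ba_dg_bialgebra : dg_bialgebra ba_bul ba_d;
  ba_odot_degree : has_degree 0 ba_odot;
  ba_infinitesimal : unital_infinitesimal ba_odot
}.

Definition is_ucoalg_hom (C D : ucoalg K) (f : C -> D) : Prop :=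
  [/\ has_degree 0 f, forall x, Delta (f x) = tmap f f (Delta x),
      forall x, eps (f x) = eps x & f uone = uone].

Definition is_biass_hom (V W : biass) (f : V -> W) : Prop :=
  [/\ is_ucoalg_hom f, forall x, f (ba_d V x) = ba_d W (f x),
      forall t, f (ba_bul V t) = ba_bul W (tmap f f t)
    & forall t, f (ba_odot V t) = ba_odot W (tmap f f t)].

Fixpoint tpow (V : lmodType K) (r : nat) : lmodType K :=
  if r is r'.+1 then tens V (tpow V r') else V.

Definition rDelta (C : ucoalg K) (x : C) : tens C C :=
  Delta x - x ⊗ uone - uone ⊗ x.

(* r-fold iterate of the reduced comultiplication of ker eps, with values in the
   (r+1)-st tensor power of C, which contains that of ker eps as a subspace. *)
Fixpoint rDelta_iter (C : ucoalg K) (r : nat) : C -> tpow C r :=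
  if r is r'.+1 return C -> tpow C r
  then fun x => tmap idfun (@rDelta_iter C r') (rDelta x) else idfun.

Definition conilpotent (C : ucoalg K) : Prop :=
  forall x : C, eps x = 0 -> exists r, rDelta_iter r x = 0.

Definition cofree (C : ucoalg K) : Prop :=
  exists (X : gvect K) (f : {linear C -> tcoalg X}),
    bijective f /\ is_ucoalg_hom f.

End Structures.

Record category := Category {
  ob : Type;
  hom : ob -> ob -> Type;
  idm : forall a, hom a a;
  comp : forall a b c, hom b c -> hom a b -> hom a c;
  comp_idl : forall a b (f : hom a b), comp (idm b) f = f;
  comp_idr : forall a b (f : hom a b), comp f (idm a) = f;
  compA : forall a b c d (h : hom c d) (g : hom b c) (f : hom a b),
    comp h (comp g f) = comp (comp h g) f
}.
Arguments comp {c0 a b c} : rename.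
Arguments idm {c} a : rename.

Record functor (C D : category) := Functor {
  fob :> ob C -> ob D;
  fmap : forall a b, hom a b -> hom (fob a) (fob b);
  fmap_id : forall a, fmap (idm a) = idm (fob a);
  fmap_comp : forall a b c (g : hom b c) (f : hom a b),
    fmap (comp g f) = comp (fmap g) (fmap f)
}.
Arguments fmap {C D} f {a b} : rename.

Definition idfunctor (C : category) : functor C C :=
  @Functor C C id (fun _ _ => id) (fun _ => erefl) (fun _ _ _ _ _ => erefl).

Section FunctorComp.
Variables (C D E : category) (G : functor D E) (F : functor C D).
Lemma fcomp_id a : fmap G (fmap F (idm a)) = idm (G (F a)).
Proof. by rewrite !fmap_id. Qed.
Lemma fcomp_comp a b c (g : hom b c) (f : hom a b) :
  fmap G (fmap F (comp g f)) = comp (fmap G (fmap F g)) (fmap G (fmap F f)).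
Proof. by rewrite !fmap_comp. Qed.
Definition fcompose : functor C E := Functor fcomp_id fcomp_comp.
End FunctorComp.

Definition nat_isomorphic (C D : category) (F G : functor C D) : Prop :=
  exists (u : forall a, hom (F a) (G a)) (v : forall a, hom (G a) (F a)),
    (forall a b (f : hom a b), comp (fmap G f) (u a) = comp (u b) (fmap F f)) /\
    (forall a, comp (v a) (u a) = idm (F a) /\ comp (u a) (v a) = idm (G a)).

Definition equivalent (C D : category) : Prop :=
  exists (F : functor C D) (G : functor D C),
    nat_isomorphic (fcompose G F) (idfunctor C) /\
    nat_isomorphic (fcompose F G) (idfunctor D).

Definition full_subcategory (C : category) (P : ob C -> Prop) : category :=
  @Category {a : ob C | P a} (fun a b => hom (sval a) (sval b))
    (fun a => idm (sval a)) (fun _ _ _ => comp)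
    (fun _ _ => @comp_idl C _ _) (fun _ _ => @comp_idr C _ _)
    (fun _ _ _ _ => @compA C _ _ _ _).

Section LinearCategory.
Variables (K : fieldType) (O : Type) (car : O -> lmodType K).
Variable P : forall a b : O, (car a -> car b) -> Prop.
Hypothesis Pid : forall a, P (a := a) (b := a) idfun.
Hypothesis Pcomp : forall a b c (g : {linear car b -> car c}) (f : {linear car a -> car b}),
  P g -> P f -> P (a := a) (b := c) (g \o f).

Definition lhom (a b : O) := {f : {linear car a -> car b} | P f}.
Definition lid a : lhom a a := exist _ (idfun : {linear car a -> car a}) (Pid a).
Definition lcomp a b c (g : lhom b c) (f : lhom a b) : lhom a c :=
  exist _ (sval g \o sval f : {linear car a -> car c}) (Pcomp (svalP g) (svalP f)).

Lemma lhom_eq a b (f g : lhom a b) : sval f =1 sval g -> f = g.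
Proof.
move=> /linear_ext; case: f g => f pf [g pg] /= E; subst g.
by congr exist; apply: Prop_irrelevance.
Qed.

Lemma lcomp_idl a b (f : lhom a b) : lcomp (lid b) f = f.
Proof. exact: lhom_eq. Qed.
Lemma lcomp_idr a b (f : lhom a b) : lcomp f (lid a) = f.
Proof. exact: lhom_eq. Qed.
Lemma lcompA a b c d (h : lhom c d) (g : lhom b c) (f : lhom a b) :
  lcomp h (lcomp g f) = lcomp (lcomp h g) f.
Proof. exact: lhom_eq. Qed.

Definition linear_category : category := Category lcomp_idl lcomp_idr lcompA.
End LinearCategory.

Section Categories.
Variable K : fieldType.

Lemma has_degree_id (V : gvect K) : has_degree 0 (idfun : V -> V).
Proof. by move=> i v; rewrite addr0. Qed.

Lemma has_degree_comp (U V W : gvect K) (g : V -> W) (f : U -> V) :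
  has_degree 0 g -> has_degree 0 f -> has_degree 0 (g \o f).
Proof. by move=> hg hf i v /hf /hg; rewrite !addr0. Qed.

Lemma is_binfty_hom_id (A : binfty K) : is_binfty_hom (idfun : A -> A).
Proof.
have E n (t : n.-tuple A) : map_tuple idfun t = t by apply: val_inj; exact: map_id.
split=> [|n t _|i j s t _ _]; first exact: has_degree_id.
  by rewrite E.
by rewrite !E.
Qed.

Lemma is_binfty_hom_comp (A B C : binfty K)
    (g : {linear B -> C}) (f : {linear A -> B}) :
  is_binfty_hom g -> is_binfty_hom f -> is_binfty_hom (g \o f).
Proof.
have E n (t : n.-tuple A) : map_tuple (g \o f) t = map_tuple g (map_tuple f t).
  by apply: val_inj; exact: map_comp.
move=> [g0 g1 g2] [f0 f1 f2]; split=> [|n t n0|i j s t i0 j0].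
- exact: has_degree_comp.
- by rewrite E /= f1 // g1.
- by rewrite !E /= f2 // g2.
Qed.

Lemma is_biass_hom_id (V : biass K) : is_biass_hom (idfun : V -> V).
Proof.
split=> [|//|t|t]; rewrite ?tmap_id //; split=> // [|x].
  exact: has_degree_id.
by rewrite tmap_id.
Qed.

Lemma is_biass_hom_comp (U V W : biass K)
    (g : {linear V -> W}) (f : {linear U -> V}) :
  is_biass_hom g -> is_biass_hom f -> is_biass_hom (g \o f).
Proof.
move=> [[g0 g1 g2 g3] g4 g5 g6] [[f0 f1 f2 f3] f4 f5 f6].
split=> [|x|t|t]; last 3 first.
- by rewrite /= f4 g4.
- by rewrite /= f5 g5 tmap_comp.
- by rewrite /= f6 g6 tmap_comp.
split=> [|x|x|] /=; last 3 first.
- by rewrite g1 f1 tmap_comp.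
- by rewrite g2 f2.
- by rewrite f3 g3.
exact: has_degree_comp.
Qed.

Definition binfty_category : category :=
  @linear_category K (binfty K) (fun A => A) (@is_binfty_hom K)
    is_binfty_hom_id is_binfty_hom_comp.

Definition biass_category : category :=
  @linear_category K (biass K) (fun V => V) (@is_biass_hom K)
    is_biass_hom_id is_biass_hom_comp.

Definition conilpotent_biass_category : category :=
  @full_subcategory biass_category (fun V : biass K => conilpotent V).

Definition cofree_biass_category : category :=
  @full_subcategory biass_category (fun V : biass K => cofree V).

End Categories.

(* Main.v *)
From HB Require Import structures.
From mathcomp Require Import all_boot all_algebra.
From mathcomp Require Import boolp.
Require Import Defs.

Set Implicit Arguments.
Unset Strict Implicit.
Unset Printing Implicit Defensive.

Import GRing.Theory.
Local Open Scope ring_scope.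

(** A B-infinity algebra [A] is sent to the tensor coalgebra on [A], with its
    product, its differential and, as the infinitesimal product, concatenation
    of words; a homomorphism [f] acts letter by letter ([tfun f]). This functor
    is shown to be fully faithful and essentially surjective onto the
    conilpotent 2-associative differential bialgebras.

    Fully faithful: the tensor coalgebra is cogenerated by its letters. A
    coalgebra map into it, and the defect of a map from commuting with
    coderivations, are determined by their components in the letters
    ([coalgebra_map2_cogenerated], [coderivation_cogenerated]), so [tfun f]
    respects product and differential as soon as [f] respects the structure
    maps ([tfun_biass_hom]). Conversely a homomorphism of bialgebras preserves
    primitive elements, which are the letters, and concatenation, so it is
    [tfun] of its restriction to letters ([biass_hom_tfun]).

    Essentially surjective: by the theorem of Loday and Ronco
    ([conilpotent_infinitesimal_tensor]) the infinitesimal product of a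
    conilpotent bialgebra [V] identifies [V] with the tensor coalgebra on its
    primitive elements; transporting product and differential along this
    isomorphism makes the space of primitives a B-infinity algebra. The key is
    the projection [p] onto the primitives, [p = unit - antipode] for the
    convolution algebra of the infinitesimal product. The antipode is the
    geometric series of [red = id - unit], which is finite on each vector by
    conilpotency. From [id * p = red = p * id] one reads off that [p] has
    primitive values ([proj_primitive]), that it kills products of a primitive
    with an element of the augmentation ideal ([proj_mul_primitive]), and that
    [v = eps(v) 1 + p(v1) v2]: iterating the last formula writes [v] as a
    combination of products of primitives, in a unique way.

    The same theorem makes a conilpotent bialgebra cofree, and a tensor
    coalgebra is conilpotent because deconcatenation shortens words
    ([conilpotent_cofree]). Hence conilpotent and cofree bialgebras form the
    same full subcategory. *)

(** * Tensor products and the convolution of linear maps *)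

Section TensorCalculus.
Variable K : fieldType.

Lemma pure_addl (V W : lmodType K) (v v' : V) (w : W) : (v + v') ⊗ w = v ⊗ w + v' ⊗ w.
Proof. by have := pureDl 1 v v' w; rewrite !scale1r. Qed.

Lemma pure_scalel (V W : lmodType K) a (v : V) (w : W) : (a *: v) ⊗ w = a *: (v ⊗ w).
Proof. by have := pureDl a v 0 w; rewrite pure0l !addr0. Qed.

Lemma pure_oppl (V W : lmodType K) (v : V) (w : W) : (- v) ⊗ w = - (v ⊗ w).
Proof. by rewrite -scaleN1r pure_scalel scaleN1r. Qed.

Lemma pure_subl (V W : lmodType K) (v v' : V) (w : W) : (v - v') ⊗ w = v ⊗ w - v' ⊗ w.
Proof. by rewrite pure_addl pure_oppl. Qed.

Definition pure_right (V W : lmodType K) (w : W) (v : V) : tens V W := v ⊗ w.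

HB.instance Definition _ (V W : lmodType K) (w : W) :=
  GRing.isLinear.Build K V (tens V W) *:%R (pure_right w)
    (fun a v v' => pureDl a v v' w).

Lemma pure_rightE (V W : lmodType K) (v : V) (w : W) : pure_right w v = v ⊗ w.
Proof. by []. Qed.

Lemma tens3_linear_eq (U V W Q : lmodType K) (f g : {linear tens (tens U V) W -> Q}) :
  (forall u v w, f ((u ⊗ v) ⊗ w) = g ((u ⊗ v) ⊗ w)) -> f =1 g.
Proof.
move=> fg; apply: tens_linear_eq => s w.
by apply: (@tens_linear_eq _ _ _ _ (f \o pure_right w) (g \o pure_right w) _ s) => u v; exact: fg.
Qed.

Lemma tmap_subl (V V' W W' : lmodType K) (f f' : {linear V -> V'}) (g : {linear W -> W'}) t :
  tmap (f \- f') g t = tmap f g t - tmap f' g t.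
Proof.
apply: (@tens_linear_eq _ _ _ _ (tmap (f \- f') g) (tmap f g \- tmap f' g) _ t) => v w /=.
by rewrite !tmapE /= pure_subl.
Qed.

Lemma tmap_subr (V V' W W' : lmodType K) (f : {linear V -> V'}) (g g' : {linear W -> W'}) t :
  tmap f (g \- g') t = tmap f g t - tmap f g' t.
Proof.
apply: (@tens_linear_eq _ _ _ _ (tmap f (g \- g')) (tmap f g \- tmap f g') _ t) => v w /=.
by rewrite !tmapE /= linearB.
Qed.

Lemma eq_tmap (V V' W W' : lmodType K) (f f' : V -> V') (g g' : W -> W') t :
  f =1 f' -> g =1 g' -> tmap f g t = tmap f' g' t.
Proof. by move=> ff gg; apply: eq_tlift => v w; rewrite ff gg. Qed.

End TensorCalculus.

Section UnitMap.
Variables (K : fieldType) (C : ucoalg K).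

(** For [v] the unit of an algebra, the unit of the convolution product. *)
Definition unit_map (V : lmodType K) (v : V) (x : C) : V := (eps x : K) *: v.

Fact unit_map_linear (V : lmodType K) (v : V) : linear (unit_map v).
Proof. by move=> a x y; rewrite /unit_map linearP /= scalerDl scalerA. Qed.
HB.instance Definition _ (V : lmodType K) (v : V) :=
  GRing.isLinear.Build K C V *:%R (unit_map v) (unit_map_linear v).

End UnitMap.

(** The projection onto [ker eps] along the unit; locked, so that rewriting
    with rules about differences does not see through it. *)
HB.lock Definition red (K : fieldType) (C : ucoalg K) (x : C) : C :=
  x - unit_map uone x.
Arguments red {K C} x.

Section Convolution.
Variables (K : fieldType) (C : ucoalg K).

Lemma redE (x : C) : red x = x - (eps x : K) *: uone.
Proof. by rewrite unlock. Qed.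

Fact red_linear : linear (@red K C).
Proof. by move=> a x y; rewrite unlock; exact: (linearP (idfun \- unit_map uone)). Qed.
HB.instance Definition _ := GRing.isLinear.Build K C C *:%R (@red K C) red_linear.

Lemma unit_map_one (V : lmodType K) (v : V) : unit_map v (uone : C) = v.
Proof. by rewrite /unit_map eps_one scale1r. Qed.

Lemma red_one : red (uone : C) = 0.
Proof. by rewrite redE eps_one scale1r subrr. Qed.

Lemma eps_red (x : C) : eps (red x) = 0.
Proof. by rewrite redE linearB linearZ /= eps_one [_ *: _]mulr1 subrr. Qed.

Lemma red_id (x : C) : eps x = 0 -> red x = x.
Proof. by move=> ex; rewrite redE ex scale0r subr0. Qed.

Lemma comp_red (V : lmodType K) (f : {linear C -> V}) x : f uone = 0 -> f (red x) = f x.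
Proof. by move=> f1; rewrite redE linearB linearZ /= f1 scaler0 subr0. Qed.

Definition contract_l (V : lmodType K) : tens C V -> V :=
  tlift (fun a v => (eps a : K) *: v).
Definition contract_r (V : lmodType K) : tens V C -> V :=
  tlift (fun v a => (eps a : K) *: v).

Fact contract_l_bilin (V : lmodType K) : bilin (fun (a : C) (v : V) => (eps a : K) *: v).
Proof.
split=> [v k a a'|a k v v']; first by rewrite linearP scalerDl scalerA.
by rewrite scalerDr !scalerA mulrC.
Qed.
Fact contract_r_bilin (V : lmodType K) : bilin (fun (v : V) (a : C) => (eps a : K) *: v).
Proof. by have [l r] := contract_l_bilin V; split. Qed.
HB.instance Definition _ (V : lmodType K) := GRing.isLinear.Build K (tens C V) V *:%R
  (@contract_l V) (tlift_linear (contract_l_bilin V)).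
HB.instance Definition _ (V : lmodType K) := GRing.isLinear.Build K (tens V C) V *:%R
  (@contract_r V) (tlift_linear (contract_r_bilin V)).

Lemma contract_lE (V : lmodType K) a (v : V) : contract_l (a ⊗ v) = (eps a : K) *: v.
Proof. exact: tlift_pure (contract_l_bilin V). Qed.
Lemma contract_rE (V : lmodType K) a (v : V) : contract_r (v ⊗ a) = (eps a : K) *: v.
Proof. exact: tlift_pure (contract_r_bilin V). Qed.
Lemma contract_l_Delta (x : C) : contract_l (Delta x) = x.
Proof. exact: counitl. Qed.
Lemma contract_r_Delta (x : C) : contract_r (Delta x) = x.
Proof. exact: counitr. Qed.

Lemma tmap_unit_l (V W : lmodType K) (v : V) (g : {linear C -> W}) x :
  tmap (unit_map v) g (Delta x) = v ⊗ g x.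
Proof.
rewrite -{2}[x]contract_l_Delta.
apply: (@tens_linear_eq _ _ _ _ (tmap (unit_map v) g) (pure v \o g \o @contract_l _)
  _ (Delta x)) => a b /=.
by rewrite tmapE contract_lE /unit_map pure_scalel linearZ /= linearZ.
Qed.

Lemma tmap_unit_r (V W : lmodType K) (w : W) (g : {linear C -> V}) x :
  tmap g (unit_map w) (Delta x) = g x ⊗ w.
Proof.
rewrite -{2}[x]contract_r_Delta.
apply: (@tens_linear_eq _ _ _ _ (tmap g (unit_map w)) (pure_right w \o g \o @contract_r _)
  _ (Delta x)) => a b /=.
by rewrite tmapE contract_rE /unit_map linearZ /= linearZ /= /pure_right pure_scalel.
Qed.

Lemma tmap_red_l (W : lmodType K) (g : {linear C -> W}) x :
  tmap red g (Delta (x : C)) = tmap idfun g (Delta x) - uone ⊗ g x.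
Proof. by rewrite -(tmap_unit_l uone) -tmap_subl; apply: eq_tmap => // y; exact: redE. Qed.

Lemma tmap_red_r (V : lmodType K) (g : {linear C -> V}) x :
  tmap g red (Delta (x : C)) = tmap g idfun (Delta x) - g x ⊗ uone.
Proof. by rewrite -(tmap_unit_r uone) -tmap_subr; apply: eq_tmap => // y; exact: redE. Qed.

(** The convolution product when [act] is a multiplication; a general pairing
    is allowed so that maps into an algebra also act by convolution on maps into
    a module over it. *)
Definition conv (U V W : lmodType K) (act : {linear tens U V -> W})
    (f : {linear C -> U}) (g : {linear C -> V}) (x : C) : W :=
  act (tmap f g (Delta x)).
Fact conv_linear (U V W : lmodType K) (act : {linear tens U V -> W})
    (f : {linear C -> U}) (g : {linear C -> V}) : linear (conv act f g).
Proof. exact: (linearP (act \o tmap f g \o Delta)). Qed.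
HB.instance Definition _ (U V W : lmodType K) (act : {linear tens U V -> W})
    (f : {linear C -> U}) (g : {linear C -> V}) :=
  GRing.isLinear.Build K C W *:%R (conv act f g) (conv_linear act f g).

Lemma convE (U V W : lmodType K) (act : {linear tens U V -> W}) f g x :
  conv act f g x = act (tmap f g (Delta x)).
Proof. by []. Qed.

Lemma eq_conv (U V W : lmodType K) (act : {linear tens U V -> W})
    (f f' : {linear C -> U}) (g g' : {linear C -> V}) x :
  f =1 f' -> g =1 g' -> conv act f g x = conv act f' g' x.
Proof. by move=> ff gg; rewrite !convE (eq_tmap _ ff gg). Qed.

(** Coassociativity turns associativity of the pairings into associativity of
    convolution; the four pairings may differ, as in the axioms of a bimodule. *)
Lemma conv_assoc (U V W P P' Q : lmodType K)
    (a1 : {linear tens U V -> P}) (a2 : {linear tens P W -> Q})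
    (b1 : {linear tens V W -> P'}) (b2 : {linear tens U P' -> Q})
    (f : {linear C -> U}) (g : {linear C -> V}) (h : {linear C -> W}) x :
  (forall u v w, a2 (a1 (u ⊗ v) ⊗ w) = b2 (u ⊗ b1 (v ⊗ w))) ->
  conv a2 (conv a1 f g) h x = conv b2 f (conv b1 g h) x.
Proof.
move=> H; rewrite !convE.
have -> : tmap (conv a1 f g) h (Delta x) =
    tmap (a1 \o tmap f g) h (tmap Delta idfun (Delta x)).
  by rewrite -tmap_comp; apply: eq_tmap.
have -> : tmap f (conv b1 g h) (Delta x) =
    tmap f (b1 \o tmap g h) (tmap idfun Delta (Delta x)).
  by rewrite -tmap_comp; apply: eq_tmap.
rewrite -coassoc.
apply: (@tens3_linear_eq _ _ _ _ _ (a2 \o tmap (a1 \o tmap f g) h)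
  (b2 \o tmap f (b1 \o tmap g h) \o @tassoc K C C C)
  _ (tmap Delta idfun (Delta x))) => u v w /=.
by rewrite tassocE !tmapE /= !tmapE.
Qed.

Lemma conv_one (U V W : lmodType K) (act : {linear tens U V -> W}) (f : {linear C -> U})
    (g : {linear C -> V}) : conv act f g uone = act (f uone ⊗ g uone).
Proof. by rewrite convE Delta_one tmapE. Qed.

Lemma conv_subl (U V W : lmodType K) (act : {linear tens U V -> W})
    (f f' : {linear C -> U}) (g : {linear C -> V}) x :
  conv act (f \- f') g x = conv act f g x - conv act f' g x.
Proof. by rewrite !convE tmap_subl linearB. Qed.

Lemma conv_subr (U V W : lmodType K) (act : {linear tens U V -> W})
    (f : {linear C -> U}) (g g' : {linear C -> V}) x :
  conv act f (g \- g') x = conv act f g x - conv act f g' x.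
Proof. by rewrite !convE tmap_subr linearB. Qed.

End Convolution.

Arguments conv : simpl never.

(** * Conilpotency *)

Section Conilpotency.
Variable K : fieldType.
Implicit Type C : ucoalg K.

Fact rDelta_linear C : linear (@rDelta K C).
Proof.
move=> a x y; rewrite /rDelta linearP pureDl pureDr !opprD !scalerBr.
by rewrite [RHS]addrACA [X in _ = X + _]addrACA.
Qed.
HB.instance Definition _ C :=
  GRing.isLinear.Build K C (tens C C) *:%R (@rDelta K C) (@rDelta_linear C).

Fact rDelta_iter_linear C r : linear (@rDelta_iter K C r).
Proof.
elim: r => [|r IH] //= a x y.
pose h : {linear C -> tpow C r} :=
  HB.pack (@rDelta_iter K C r) (GRing.isLinear.Build _ _ _ _ _ IH).
by rewrite linearP; exact: (linearP (tmap idfun h)).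
Qed.
HB.instance Definition _ C r :=
  GRing.isLinear.Build K C (tpow C r) *:%R (@rDelta_iter K C r) (@rDelta_iter_linear C r).

Lemma tmap_red_rDelta C (x : C) : eps x = 0 -> tmap idfun red (rDelta x) = rDelta x.
Proof.
move=> ex; rewrite {1}/rDelta !linearB /= !tmapE /= red_one linear0 subr0.
by rewrite tmap_red_r tmap_id red_id.
Qed.

Lemma rDelta_redE C (x : C) : eps x = 0 -> rDelta x = tmap red red (Delta x).
Proof. by move=> ex; rewrite tmap_red_l /= tmap_red_r tmap_id red_id. Qed.

Lemma rDelta_iterS_red C r (x : C) :
  rDelta_iter r.+1 (red x) = tmap red (@rDelta_iter K C r \o red) (Delta (red x)).
Proof.
rewrite /= rDelta_redE ?eps_red // -tmap_comp; exact: eq_tmap.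
Qed.

Lemma tmap_Delta_rDelta C (U W : lmodType K) (f : {linear C -> U}) (g : {linear C -> W}) (x : C) :
  f uone = 0 -> g uone = 0 -> tmap f g (Delta x) = tmap f g (rDelta x).
Proof. by move=> f1 g1; rewrite /rDelta !linearB /= !tmapE f1 g1 linear0 pure0l !subr0. Qed.

(** As [f] and the [D k] kill the unit, each step of the recursion only sees the
    reduced comultiplication; unwinding it [n] times writes [D n] as a linear map
    applied to the [n]-fold reduced comultiplication. *)
Lemma conv_rec_eq0 C (U W : lmodType K) (act : {linear tens U W -> W})
    (f : {linear C -> U}) (D : nat -> {linear C -> W}) n x :
  f uone = 0 -> (forall k, D k uone = 0) ->
  (forall k y, D k.+1 y = conv act f (D k) y) ->
  rDelta_iter n (red x) = 0 -> D n x = 0.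
Proof.
move=> f1 D1 DS.
suff [E ->] : exists E : {linear tpow C n -> W}, forall y, D n y = E (rDelta_iter n (red y)).
  by move=> ->; rewrite linear0.
elim: n => [|n [E IH]]; first by exists (D 0) => y; rewrite /= comp_red.
exists (act \o tmap f E) => y.
rewrite -(comp_red _ (D1 _)) DS convE tmap_Delta_rDelta //= -(tmap_red_rDelta (eps_red y)).
rewrite -[in RHS]tmap_comp -[in RHS]tmap_comp; rewrite -[in LHS]tmap_comp; congr (act _).
by apply: eq_tmap => // z; rewrite /= IH (comp_red _ (red_one C)).
Qed.

Lemma conv_rec_eventually0 C (U W : lmodType K) (act : {linear tens U W -> W})
    (f : {linear C -> U}) (D : nat -> {linear C -> W}) x :
  conilpotent C -> f uone = 0 -> (forall k, D k uone = 0) ->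
  (forall k y, D k.+1 y = conv act f (D k) y) ->
  exists n, forall m, (n <= m)%N -> D m x = 0.
Proof.
move=> nilC f1 D1 DS; have [n hn] := nilC _ (eps_red x); exists n => m nm.
rewrite -(subnK nm).
(* [D m] is also the [n]-th term of the sequence shifted by [m - n]. *)
exact: (@conv_rec_eq0 _ _ _ _ _ (fun k => D (m - n + k)%N) n x f1
  (fun=> D1 _) (fun k y => etrans (congr1 (fun j => D j y) (addnS _ _)) (DS _ _))).
Qed.

(** The uniqueness principle behind all identities below between maps defined by
    convolution: the difference of the two sides is shown to satisfy [D = f * D]
    with [f] killing the unit. *)
Lemma conv_fixpoint_eq0 C (U W : lmodType K) (act : {linear tens U W -> W})
    (f : {linear C -> U}) (D : {linear C -> W}) x :
  conilpotent C -> f uone = 0 -> D uone = 0 ->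
  (forall y, D y = conv act f D y) -> D x = 0.
Proof.
move=> nilC f1 D1 DS; have [n hn] := nilC _ (eps_red x).
exact: (@conv_rec_eq0 _ _ _ act _ (fun=> D) n x f1).
Qed.

End Conilpotency.

(** * The projection onto the primitive elements *)

Definition primitive (K : fieldType) (C : ucoalg K) (x : C) :=
  Delta x = x ⊗ uone + uone ⊗ x.

Section PrimitiveProjection.
Variables (K : fieldType) (C : ucoalg K) (m : {linear tens C C -> C}).
Hypotheses (nilC : conilpotent C) (infm : unital_infinitesimal m).

Let m_assoc a b c : m (m (a ⊗ b) ⊗ c) = m (a ⊗ m (b ⊗ c)).
Proof. by have [[]] := infm. Qed.
Let m_onel a : m (uone ⊗ a) = a.
Proof. by have [[]] := infm. Qed.
Let m_oner a : m (a ⊗ uone) = a.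
Proof. by have [[]] := infm. Qed.

(** The partial sums of [red - red * red + red * red * red - ...]. *)
Fixpoint proj_approx n : {linear C -> C} :=
  if n is k.+1 then red \- conv m red (proj_approx k) else \0.

Lemma proj_approx_one n : proj_approx n uone = 0.
Proof.
by case: n => //= n; rewrite conv_one /= red_one pure0l linear0 subr0.
Qed.

Lemma proj_approx_stable x :
  exists n, forall k, (n <= k)%N -> proj_approx k x = proj_approx n x.
Proof.
(* Consecutive partial sums differ by a convolution power of [red] up to sign. *)
have [|k|k y|n hn] := @conv_rec_eventually0 _ C _ _ (\- m) red
  (fun k => proj_approx k.+1 \- proj_approx k) x nilC.
- exact: red_one.
- by rewrite -[LHS]/(proj_approx k.+1 uone - proj_approx k uone) !proj_approx_one subrr.
- have -> : conv (\- m) red (proj_approx k.+1 \- proj_approx k) y =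
      - conv m red (proj_approx k.+1 \- proj_approx k) y by [].
  by rewrite conv_subr /= !opprB [LHS]addrC addrA subrK.
exists n => k /subnK <-; elim: (k - n)%N => // j IH.
by apply/eqP; rewrite -subr_eq0 -[X in _ - X]IH -[X in X == 0]/((proj_approx (j + n).+1 \-
  proj_approx (j + n)) x) hn ?leq_addl.
Qed.

(** The equation says that the convolution of the identity with [p] is [red],
    i.e. that [p] is the unit map minus the antipode; the partial sums above are
    stationary on each vector, and their limit satisfies it. *)
Lemma primitive_projection_exists :
  exists p : {linear C -> C}, forall x, p x = red x - conv m red p x.
Proof.
have [q hq] := choice proj_approx_stable.
pose p x := proj_approx (q x) x.
have pE x n : (q x <= n)%N -> p x = proj_approx n x by move=> h; rewrite (hq x).
have p_linear : linear p.
  move=> a x y; set n := (q (a *: x + y)%R + (q x + q y))%N.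
  have nx : (q x <= n)%N by rewrite /n addnCA leq_addr.
  have ny : (q y <= n)%N by rewrite /n addnA leq_addl.
  by rewrite (pE x n) // (pE y n) // (pE _ n) ?leq_addr // linearP.
pose lp : {linear C -> C} := HB.pack p (GRing.isLinear.Build _ _ _ _ p p_linear).
exists lp => x.
(* [Delta x] is a finite sum, so one partial sum serves for all its terms. *)
have [n hn] : exists n, forall k, (n <= k)%N ->
    m (tmap red lp (Delta x)) = m (tmap red (proj_approx k) (Delta x)).
  elim/tens_ind: (Delta x) => [|a v w t [n hn]].
    by exists 0 => k _; rewrite !tmap0.
  exists (n + q w)%N => k nk; rewrite !tmap_linear [LHS]linearP [RHS]linearP !tmapE.
  have -> : lp w = proj_approx k w by apply: pE; exact: leq_trans (leq_addl _ _) nk.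
  by congr (_ + _); apply: hn; exact: leq_trans (leq_addr _ _) nk.
rewrite [LHS](@pE x (n + q x).+1) /=; last by rewrite leqW ?leq_addl.
by rewrite convE -hn ?leq_addr.
Qed.

Section Projection.
Variable p : {linear C -> C}.
Hypothesis pE : forall x, p x = red x - conv m red p x.

Lemma proj_one : p uone = 0.
Proof. by rewrite pE conv_one /= red_one pure0l linear0 subr0. Qed.

Lemma conv_red_proj x : conv m red p x = red x - p x.
Proof. by rewrite [in RHS]pE opprB addrC subrK. Qed.

Lemma conv_id_proj x : conv m idfun p x = red x.
Proof.
rewrite convE.
have -> : tmap idfun p (Delta x) = tmap red p (Delta x) + uone ⊗ p x.
  by rewrite tmap_red_l subrK.
by rewrite linearD -convE m_onel conv_red_proj subrK.
Qed.

(** [p] is a power series in [red], so the two commute; formally, their commutator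
    [D] satisfies [D = - red * D]. *)
Lemma conv_red_proj_comm x : conv m red p x = conv m p red x.
Proof.
apply/eqP; rewrite -subr_eq0; apply/eqP.
apply: (@conv_fixpoint_eq0 _ C _ _ (\- m) red (conv m red p \- conv m p red)) => //.
- exact: red_one.
- by rewrite /= !conv_one /= red_one proj_one pure0l linear0 subrr.
move=> y.
have -> : conv (\- m) red (conv m red p \- conv m p red) y =
  - conv m red (conv m red p \- conv m p red) y by [].
have redp : conv m red p y = conv m red red y - conv m red (conv m red p) y.
  by rewrite -conv_subr; apply: eq_conv => // z; rewrite /= pE.
have pred : conv m p red y = conv m red red y - conv m red (conv m p red) y.
  rewrite -(conv_assoc red p red y m_assoc) -conv_subl.
  by apply: eq_conv => // z; rewrite /= pE.
rewrite conv_subr opprB [LHS]/= redp pred opprB.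
by rewrite [LHS]addrC addrA subrK.
Qed.

Lemma conv_proj_id x : conv m p idfun x = red x.
Proof.
rewrite convE.
have -> : tmap p idfun (Delta x) = tmap p red (Delta x) + p x ⊗ uone.
  by rewrite tmap_red_r subrK.
by rewrite linearD -convE m_oner -conv_red_proj_comm conv_red_proj subrK.
Qed.

Definition left_action_pure (a : C) (s : tens C C) : tens C C := tmap (m \o pure a) idfun s.

Fact left_action_bilin : bilin left_action_pure.
Proof.
split=> [s k a a'|a]; last exact: tmap_linear.
by apply: tlift_combf => [||v w]; try exact: tmap_bilin; rewrite /= pureDl linearP pureDl.
Qed.

(** With [right_action], the outer bimodule structure of [C ⊗ C] over [C]. *)
Definition left_action : tens C (tens C C) -> tens C C := tlift left_action_pure.
HB.instance Definition _ := GRing.isLinear.Build K (tens C (tens C C)) (tens C C) *:%R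
  left_action (tlift_linear left_action_bilin).
Definition right_action (t : tens (tens C C) C) : tens C C := tmap idfun m (tassoc t).
Fact right_action_linear : linear right_action.
Proof. exact: (linearP (tmap idfun m \o @tassoc K C C C)). Qed.
HB.instance Definition _ := GRing.isLinear.Build K (tens (tens C C) C) (tens C C) *:%R
  right_action right_action_linear.

Lemma left_actionE a s : left_action (a ⊗ s) = tmap (m \o pure a) idfun s.
Proof. exact: tlift_pure left_action_bilin. Qed.

Lemma right_actionE a b c : right_action ((a ⊗ b) ⊗ c) = a ⊗ m (b ⊗ c).
Proof. by rewrite /right_action tassocE tmapE. Qed.

Lemma right_action_pure_right s y :
  right_action (s ⊗ y) = tmap idfun (m \o pure_right y) s.
Proof.
apply: (@tens_linear_eq _ _ _ _ (right_action \o pure_right y)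
  (tmap idfun (m \o pure_right y)) _ s) => a b.
by rewrite [LHS]right_actionE [RHS]tmapE.
Qed.

Lemma Delta_mul x y :
  Delta (m (x ⊗ y)) = right_action (Delta x ⊗ y) + left_action (x ⊗ Delta y) - x ⊗ y.
Proof. by have [_ ->] := infm; rewrite right_action_pure_right left_actionE. Qed.

(** The compatibility of an infinitesimal bialgebra, rewritten: the map
    [Delta - 1 ⊗ id], which is [tmap red idfun \o Delta], is a derivation, without
    the correction term [x ⊗ y]. *)
Lemma Delta_red_derivation x y :
  tmap red idfun (Delta (m (x ⊗ y))) =
  right_action (tmap red idfun (Delta x) ⊗ y) + left_action (x ⊗ tmap red idfun (Delta y)).
Proof.
rewrite !tmap_red_l !tmap_id Delta_mul pure_subl !linearB /= right_actionE left_actionE.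
rewrite [left_action (x ⊗ (uone ⊗ y))]left_actionE tmapE /= m_oner.
by rewrite [RHS]addrACA [X in _ = _ + X]addrC addrA.
Qed.

(** Write [D] for the derivation [Delta - 1 ⊗ id]. The claim is that the map
    [E = D \o p - p ⊗ 1] vanishes. Applying [D] to [p = red - red * p] and using
    [id * p = red] gives [E = - red * E], with [*] the left action. *)
Lemma proj_primitive x : primitive (p x).
Proof.
have D1 : tmap red idfun (Delta (uone : C)) = 0 by rewrite Delta_one tmapE /= red_one pure0l.
rewrite /primitive; suff : tmap red idfun (Delta (p x)) - p x ⊗ uone = 0.
  by move/eqP; rewrite subr_eq0 => /eqP <-; rewrite tmap_red_l tmap_id subrK.
apply: (@conv_fixpoint_eq0 _ C _ _ (\- left_action) red
  ((conv idfun red idfun \o p) \- (pure_right uone \o p))) => //.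
- exact: red_one.
- by rewrite /= proj_one !linear0 addr0.
move=> {}x.
have -> : conv (\- left_action) red ((conv idfun red idfun \o p) \- (pure_right uone \o p)) x =
  - conv left_action red ((conv idfun red idfun \o p) \- (pure_right uone \o p)) x by [].
rewrite conv_subr /=.
have -> : conv left_action red (pure_right uone \o p) x = (red x - p x) ⊗ uone.
  rewrite -conv_red_proj.
  apply: (@tens_linear_eq _ _ _ _ (left_action \o tmap red (pure_right uone \o p))
    (pure_right uone \o m \o tmap red p) _ (Delta x)) => a b.
  by rewrite /= !tmapE /= left_actionE /pure_right tmapE.
have -> : conv idfun red idfun (p x) =
    conv idfun red idfun x - (conv idfun red idfun x - red x ⊗ uone)
    - conv left_action red (conv idfun red idfun \o p) x.
  rewrite {1}pE linearB /= -/(red _) (comp_red x (f := conv idfun red idfun)) //.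
  rewrite -addrA -opprD; congr (_ - _).
  have -> : conv idfun red idfun x - red x ⊗ uone = conv idfun red (conv m idfun p) x.
    rewrite convE -tmap_red_r; apply: eq_tmap => // y; exact/esym/conv_id_proj.
  rewrite -(@conv_assoc _ _ _ _ _ _ _ _ idfun right_action); last exact: right_actionE.
  rewrite -(@eq_conv _ _ _ _ _ right_action (conv idfun red idfun \o red) _ p p) //; last first.
    by move=> y; rewrite /= comp_red.
  apply: (@tens_linear_eq _ _ _ _ (conv idfun red idfun \o m \o tmap red p)
    ((right_action \o tmap (conv idfun red idfun \o red) p) \+
     (left_action \o tmap red (conv idfun red idfun \o p))) _ (Delta x)) => a b.
  by rewrite /= !tmapE /= [LHS]Delta_red_derivation.
by rewrite pure_subl !opprB [X in X - _ - _]addrC subrK [LHS]addrAC.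
Qed.

Lemma eps_primitive (x : C) : primitive x -> eps x = 0.
Proof.
move=> px; have := congr1 (@contract_l _ C _) px.
rewrite linearD /= !contract_lE contract_l_Delta eps_one scale1r => /eqP.
rewrite -subr_eq subrr => /eqP /(congr1 eps).
rewrite linear0 linearZ /= eps_one => ex.
by rewrite -[LHS](mulr1 (eps x : K)); exact: esym ex.
Qed.

(** Multiplying by a primitive element on the left changes the comultiplication
    as putting a letter in front of a word changes deconcatenation. *)
Lemma Delta_mul_primitive q x : primitive q ->
  Delta (m (q ⊗ x)) = uone ⊗ m (q ⊗ x) + tmap (m \o pure q) idfun (Delta x).
Proof.
move=> pq; rewrite Delta_mul pq pure_addl linearD /= !right_actionE m_onel left_actionE.
by rewrite addrAC [X in X - _]addrC addrK.
Qed.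

(** Contracting the previous formula with the counit shows that the left
    contraction of its last summand vanishes; the counit of that contraction is
    also the counit of [m (q ⊗ x)]. *)
Lemma eps_mul_primitive q x : primitive q -> eps (m (q ⊗ x)) = 0.
Proof.
move=> pq; have := congr1 (@contract_l _ C _) (Delta_mul_primitive x pq).
rewrite linearD /= contract_lE contract_l_Delta eps_one scale1r => /eqP.
rewrite -subr_eq0 opprD addNKr oppr_eq0 => /eqP /(congr1 eps); rewrite linear0 => <-.
rewrite -{1}[x]contract_r_Delta.
apply: (@tens_linear_eq _ _ _ _ (eps \o m \o pure q \o @contract_r _ _ _)
  (eps \o @contract_l _ _ _ \o tmap (m \o pure q) idfun) _ (Delta x)) => a b.
rewrite /= tmapE /= contract_lE contract_rE !linearZ /=; exact: mulrC.
Qed.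

(** By the previous formulas [red * p] sends [m (q ⊗ x)] to [m (q ⊗ y)] with
    [y = (id * p) x = red x], and [p = red - red * p]. *)
Lemma proj_mul_primitive q x : primitive q -> p (m (q ⊗ x)) = (eps x : K) *: q.
Proof.
move=> pq; rewrite pE convE Delta_mul_primitive // linearD /= tmapE /= red_one pure0l add0r.
rewrite -tmap_comp red_id ?eps_mul_primitive //.
have -> : m (tmap (red \o (m \o pure q)) (p \o idfun) (Delta x)) = m (q ⊗ red x).
  rewrite -conv_id_proj.
  have -> : tmap (red \o (m \o pure q)) (p \o idfun) (Delta x) = tmap (m \o pure q) p (Delta x).
    by apply: eq_tmap => // y; rewrite /= red_id // eps_mul_primitive.
  apply: (@tens_linear_eq _ _ _ _ (m \o tmap (m \o pure q) p)
    (m \o pure q \o m \o tmap idfun p) _ (Delta x)) => a b.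
  by rewrite /= !tmapE /= m_assoc.
by rewrite redE !linearB /= opprK addrA subrr add0r !linearZ /= m_oner.
Qed.

End Projection.
End PrimitiveProjection.

(** * The tensor coalgebra *)

Section Degree.
Variable K : fieldType.

Lemma has_degree_gcomp (V W : gvect K) k (f : {linear V -> W}) i v :
  has_degree k f -> gcomp W (i + k) (f v) = f (gcomp V i v).
Proof.
move=> fk; apply: (@span_linear_eq _ _ _ _ (gcomp W (i + k) \o f) (f \o gcomp V i) _ _
  (homog_span v)).
move=> u [d hu] /=; rewrite (gcompE _ hu) (gcompE _ (fk _ _ hu)) (inj_eq (addIr _)).
by case: eqP => //; rewrite linear0.
Qed.

Lemma has_degree_span (V W : gvect K) k (f : {linear V -> W}) (G : V -> Prop) :
  (forall u, G u -> exists2 d, homog d u & homog (d + k) (f u)) ->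
  (forall v, span G v) -> has_degree k f.
Proof.
move=> fG spG i v hv; rewrite /homog -{2}hv.
apply: (@span_linear_eq _ _ _ _ (gcomp W (i + k) \o f) (f \o gcomp V i) _ _ (spG v)).
move=> u /fG [d hu hfu] /=; rewrite (gcompE _ hu) (gcompE _ hfu) (inj_eq (addIr _)).
by case: eqP => //; rewrite linear0.
Qed.

End Degree.

Section TensorCoalgebra.
Variables (K : fieldType) (X : gvect K).
Local Notation T := (tcoalg X).
Local Arguments tcoalg : simpl never.

Lemma talg_linear_eq (U : lmodType K) (f g : {linear T -> U}) :
  (forall w, f (word w : T) = g (word w : T)) -> f =1 g.
Proof. by move=> fg t; apply: span_linear_eq (talg_span t) => _ [w ->]. Qed.

Definition cons_map : tens X T -> T := tlift (@tcons K X).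

Fact tcons_bilin : bilin (@tcons K X).
Proof. by split=> [t a x y|x]; [exact: tconsDl|exact: tcons_linear]. Qed.
HB.instance Definition _ := GRing.isLinear.Build K (tens X T) T *:%R
  cons_map (tlift_linear tcons_bilin).

Lemma cons_mapE x (t : T) : cons_map (x ⊗ t) = tcons x t.
Proof. exact: tlift_pure tcons_bilin. Qed.

Lemma tcoalg_DeltaE w :
  Delta (word w : T) = \sum_(i < (size w).+1) (word (take i w) : T) ⊗ (word (drop i w) : T).
Proof. exact: deconcE. Qed.

Lemma tcoalg_epsE w : eps (word w : T) = (w == [::])%:R :> K.
Proof. by rewrite [LHS]wcounitE; case: w. Qed.

Lemma Delta_tcons x (t : T) : Delta (tcons x t : T) =
  (uone : T) ⊗ (tcons x t : T) + tmap (tcons x : T -> T) (idfun : T -> T) (Delta t).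
Proof. exact: deconc_tcons. Qed.

(** Since the right factor on the right-hand side is shorter, this is a recursion
    that determines a tensor from the letter components of its deconcatenation;
    cogeneration by letters rests on it. *)
Lemma split_first_letter (t : T) :
  t = (eps t : K) *: (uone : T) + cons_map (tmap (@wproj1 K X : T -> X) (idfun : T -> T) (Delta t)).
Proof.
apply: (@talg_linear_eq T idfun (unit_map (C := T) (uone : T) \+
  (cons_map \o tmap (@wproj1 K X : T -> X) (idfun : T -> T) \o @Delta _ T)) _ t) => {t} [[|x w]] /=.
  rewrite tcoalg_DeltaE big_ord1 tmapE /= cons_mapE wproj1E tcons0l addr0.
  by rewrite /unit_map tcoalg_epsE scale1r.
rewrite /unit_map tcoalg_epsE scale0r add0r.
rewrite -tcons_wordE Delta_tcons linearD /= tmapE /= linearD /= cons_mapE wproj1E tcons0l add0r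
  -tmap_comp.
have -> : tmap (@wproj1 K X \o tcons x) (idfun \o idfun) (Delta (word w : T)) =
   tmap (unit_map x) idfun (Delta (word w : T)).
  apply: eq_tmap => // t; apply: (@talg_linear_eq _ (@wproj1 K X \o (tcons x : T -> T)) (unit_map
    (C := T) x)) => {w t} w.
  by rewrite /= tcons_wordE wproj1E /unit_map tcoalg_epsE; case: w => [|y w] /=; rewrite ?scale1r
    ?scale0r.
by rewrite tmap_unit_l cons_mapE.
Qed.

Lemma rDelta_iter_word r w : (size w <= r)%N -> rDelta_iter r (red (word w : T)) = 0.
Proof.
elim: r w => [|r IH] [|x w] // sw; try by rewrite red_one linear0.
rewrite rDelta_iterS_red red_id ?tcoalg_epsE // tcoalg_DeltaE linear_sum.
apply: big1 => -[i lti] _; rewrite [LHS]tmapE.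
case: i lti => [|i] lti; first by rewrite take0 [X in X ⊗ _](red_one T) pure0l.
rewrite [X in _ ⊗ X]IH ?linear0 // size_drop leq_subLR (leq_trans sw) //.
by rewrite addSn ltnS leq_addl.
Qed.

Lemma tcoalg_conilpotent : conilpotent T.
Proof.
move=> t /red_id <-.
suff [r rP] : exists r, forall k, (r <= k)%N -> rDelta_iter k (red t) = 0 by exists r; exact: rP.
elim/talg_ind: t => [|a w t [r IH]]; first by exists 0 => k _; rewrite !linear0.
exists (r + size w)%N => k rk; rewrite !linearP /= IH ?(leq_trans (leq_addr _ _) rk) //.
by rewrite rDelta_iter_word ?scaler0 ?addr0 // (leq_trans (leq_addl _ _) rk).
Qed.

(** ** Concatenation *)

Definition conc_word (t : talg X) (w : seq X) : talg X := foldr (@tcons K X) t w.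

Fact conc_word_multilin t : multilin (conc_word t).
Proof.
move=> u v a x y; elim: u => [|z u IH] /=; first exact: tconsDl.
by rewrite IH linearP.
Qed.

Lemma conc_word_linear w a t t' : conc_word (a *: t + t') w = a *: conc_word t w + conc_word t' w.
Proof. by elim: w => //= x w ->; rewrite linearP. Qed.

Definition conc_pure (s t : T) : T := wlift (conc_word t) s.

Fact conc_pure_bilin : bilin conc_pure.
Proof.
split=> [t|s a t t']; first exact: wlift_linear (conc_word_multilin t).
have L u := wlift_linear (conc_word_multilin u).
pose h u : {linear talg X -> talg X} := HB.pack (wlift (conc_word u)) (GRing.isLinear.Build _ _ _
  _ _ (L u)).
apply: (@talg_linear_eq _ (h (a *: t + t')) (a \*: h t \+ h t') _ s) => w /=.
by rewrite !wlift_word ?conc_word_linear //; exact: conc_word_multilin.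
Qed.

Definition conc : tens T T -> T := tlift conc_pure.
HB.instance Definition _ := GRing.isLinear.Build K (tens T T) T *:%R
  conc (tlift_linear conc_pure_bilin).

Lemma conc_wordl w (t : T) : conc ((word w : T) ⊗ t) = foldr (@tcons K X) t w.
Proof.
rewrite /conc tlift_pure; last exact: conc_pure_bilin.
exact: wlift_word (conc_word_multilin t).
Qed.

Lemma concE u w : conc ((word u : T) ⊗ (word w : T)) = word (u ++ w).
Proof. by rewrite conc_wordl; elim: u => //= x u ->; rewrite tcons_wordE. Qed.

Lemma conc_tcons x (s t : T) : conc ((tcons x s : T) ⊗ t) = tcons x (conc (s ⊗ t)).
Proof.
apply: (@talg_linear_eq _ (conc \o pure_right t \o (tcons x : T -> T)) ((tcons x : T -> T) \o
  conc \o pure_right t) _ s) => w.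
by rewrite /= tcons_wordE /pure_right !conc_wordl.
Qed.

Lemma conc_assoc_unital : assoc_unital conc (uone : T).
Proof.
split=> [a b c|a|a]; last 2 first.
- exact: conc_wordl.
- apply: (@talg_linear_eq _ (conc \o pure_right (uone : T)) idfun _ a) => w.
  by rewrite /= [pure_right _ _]/(_ ⊗ _) concE cats0.
apply: (@talg_linear_eq _ (conc \o pure_right c \o conc \o pure_right b)
  (conc \o pure_right (conc (b ⊗ c))) _ a) => w.
rewrite /= /pure_right !conc_wordl; elim: w => //= x w IH.
by rewrite conc_tcons IH.
Qed.

(** Induction on the left word: by [Delta_tcons] and [conc_tcons], putting a letter
    in front of it changes both sides in the same way. *)
Lemma conc_infinitesimal : unital_infinitesimal conc.
Proof.
split=> [|s t]; first exact: conc_assoc_unital.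
rewrite -[tlift _ (Delta s)]/(tmap idfun (conc \o pure_right t) (Delta s)).
rewrite -[tlift _ (Delta t)]/(tmap (conc \o pure s) idfun (Delta t)).
have conc1 (u : T) : conc ((word [::] : T) ⊗ u) = u by exact: conc_wordl.
rewrite -[tmap (conc \o pure s) idfun (Delta t)]left_actionE.
apply: (@talg_linear_eq _ (@Delta _ T \o conc \o pure_right t) ((tmap idfun (conc \o pure_right
  t) \o
  @Delta _ T) \+ (left_action conc \o pure_right (Delta t)) \- pure_right t) _ s) => {s}.
suff main w : Delta (conc ((word w : T) ⊗ t)) =
    tmap idfun (conc \o pure_right t) (Delta (word w : T)) +
    tmap (conc \o pure (word w : T)) idfun (Delta t) - (word w : T) ⊗ t.
  by move=> w; rewrite [LHS]main -left_actionE.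
elim: w => [|x w IH].
  have -> : Delta (word [::] : T) = (word [::] : T) ⊗ (word [::] : T) by exact: Delta_one.
  have -> : tmap idfun (conc \o pure_right t) ((word [::] : T) ⊗ (word [::] : T)) = (word [::] :
    T) ⊗ t.
    by rewrite tmapE; congr (_ ⊗ _); exact: conc1.
  rewrite conc1 [X in X - _]addrC addrK.
  by rewrite -{1}[Delta t]tmap_id; apply: eq_tmap => // u; exact/esym/conc1.
rewrite -tcons_wordE Delta_tcons conc_tcons Delta_tcons IH.
pose TX : {linear tens T T -> tens T T} := tmap (tcons x : T -> T) (idfun : T -> T).
pose R : {linear tens T T -> tens T T} := tmap (idfun : T -> T) (conc \o pure_right t).
rewrite -[tmap idfun (conc \o pure_right t) (Delta _)]/(R (Delta (word w : T))).
rewrite -[tmap (tcons x : T -> T) idfun (Delta (word w : T))]/(TX (Delta (word w : T))).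
rewrite -[tmap (tcons x : T -> T) idfun _]/(TX _) -[tmap idfun _ _]/(R _).
rewrite (linearB TX) (linearD TX) (linearD R).
have -> : TX (R (Delta (word w : T))) = R (TX (Delta (word w : T))).
  by rewrite -[LHS]tmap_comp -[RHS]tmap_comp.
have -> : TX (tmap (conc \o pure (word w : T)) idfun (Delta t)) =
    tmap (conc \o pure (tcons x (word w) : T)) idfun (Delta t).
  by rewrite -[LHS]tmap_comp; apply: eq_tmap => // u; exact/esym/conc_tcons.
have -> : TX ((word w : T) ⊗ t) = (tcons x (word w) : T) ⊗ t by exact: tmapE.
have -> : R ((uone : T) ⊗ (tcons x (word w) : T)) = (uone : T) ⊗ (tcons x (conc ((word w : T) ⊗
  t)) : T).
  by rewrite -conc_tcons; exact: tmapE.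
by rewrite !addrA.
Qed.

End TensorCoalgebra.

(** * Naturality and transport of structure *)

Section Naturality.
Variable K : fieldType.

Lemma tens_span_span (V W : lmodType K) (GV : V -> Prop) (GW : W -> Prop) :
  (forall v, span GV v) -> (forall w, span GW w) ->
  forall t : tens V W, span (fun t => exists v w, [/\ GV v, GW w & t = v ⊗ w]) t.
Proof.
move=> spV spW; elim/tens_ind => [|a v w t IH]; first exact: span0.
apply: span_add => //; apply: span_scale.
elim: (spV v) => [|b v1 v2 GV1 _ IHv]; first by rewrite pure0l; exact: span0.
rewrite pureDl; apply: span_add => //; apply: span_scale.
elim: (spW w) => [|c w1 w2 GW1 _ IHw]; first by rewrite pure0r; exact: span0.
rewrite pureDr; apply: span_add => //; apply: span_scale.
by apply: span_gen; exists v1, w1.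
Qed.

Lemma has_degree_tmap (V V' W W' : gvect K) (f : {linear V -> V'}) (g : {linear W -> W'}) :
  has_degree 0 f -> has_degree 0 g -> has_degree 0 (tmap f g : tens V W -> tens V' W').
Proof.
move=> f0 g0; apply: has_degree_span (@gtens_span K V W) => _ [v [w [[i hv] [j hw] ->]]].
exists (i + j); first exact: homog_pure.
rewrite addr0 /= tmapE; apply: homog_pure; first by rewrite -[i]addr0; exact: f0.
by rewrite -[j]addr0; exact: g0.
Qed.

Lemma koszul_natural (V W : gvect K) (f : {linear V -> W}) k v :
  has_degree 0 f -> koszul W k (f v) = f (koszul V k v).
Proof.
move=> f0; apply: (@span_linear_eq _ _ _ _ (koszul W k \o f) (f \o koszul V k) _ _ (homog_span v)).
move=> u [i hu] /=; rewrite (koszulE _ hu) linearZ /= (@koszulE _ _ _ i) //.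
by rewrite -[i]addr0; exact: f0.
Qed.

(** Only the two exchanged factors enter the sign, so only [fB] and [fC] need to
    preserve degrees. *)
Lemma tinter_natural (A B C D A' B' C' D' : gvect K)
    (fA : {linear A -> A'}) (fB : {linear B -> B'})
    (fC : {linear C -> C'}) (fD : {linear D -> D'}) t :
  has_degree 0 fB -> has_degree 0 fC ->
  tinter (tmap (tmap fA fB) (tmap fC fD) t) =
  tmap (tmap fA fC) (tmap fB fD) (@tinter K A B C D t).
Proof.
move=> fB0 fC0.
pose L : {linear tens (tens A B) (tens C D) -> tens (tens A' C') (tens B' D')} :=
  @tinter K A' B' C' D' \o tmap (tmap fA fB) (tmap fC fD).
pose R : {linear tens (tens A B) (tens C D) -> tens (tens A' C') (tens B' D')} :=
  tmap (tmap fA fC) (tmap fB fD) \o @tinter K A B C D.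
apply: (@tens3_linear_eq _ _ _ _ _ L R) => a b.
apply: (@tens_linear_eq _ _ _ _ (L \o pure (a ⊗ b)) (R \o pure (a ⊗ b))) => c d.
apply: (@span_linear_eq _ _ _ _ (L \o pure_right (c ⊗ d) \o pure a)
  (R \o pure_right (c ⊗ d) \o pure a) _ _ (homog_span b)) => {}b [i hb].
apply: (@span_linear_eq _ _ _ _ (L \o pure (a ⊗ b) \o pure_right d)
  (R \o pure (a ⊗ b) \o pure_right d) _ _ (homog_span c)) => {}c [j hc].
rewrite /= /pure_right (tinterE _ _ hb hc) linearZ /= !tmapE /= !tmapE.
by apply: tinterE; [rewrite -[i]addr0; exact: fB0|rewrite -[j]addr0; exact: fC0].
Qed.

Lemma Delta2_natural (C D : ucoalg K) (f : {linear C -> D}) t :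
  is_ucoalg_hom f -> Delta2 (tmap f f t) = tmap (tmap f f) (tmap f f) (Delta2 t).
Proof.
move=> [f0 fDelta _ _]; rewrite /Delta2 -tinter_natural // -!tmap_comp.
by congr (tinter _); apply: eq_tmap => x /=; rewrite fDelta.
Qed.

Fact eps2_bilin (C : ucoalg K) : bilin (fun a b : C => (eps a * eps b : K^o)).
Proof.
split=> [b k a a'|a k b b']; rewrite linearP /=; first by rewrite mulrDl -mulrA.
by rewrite mulrDr mulrCA.
Qed.

HB.instance Definition _ (C : ucoalg K) := GRing.isLinear.Build K (tens C C) K^o *:%R
  (@eps2 K C) (tlift_linear (eps2_bilin C)).

Lemma eps2E (C : ucoalg K) (a b : C) : eps2 (a ⊗ b) = (eps a : K) * (eps b : K).
Proof. exact: tlift_pure (eps2_bilin C). Qed.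

Lemma eps2_natural (C D : ucoalg K) (f : {linear C -> D}) t :
  is_ucoalg_hom f -> eps2 (tmap f f t) = eps2 t.
Proof.
move=> [_ _ feps _].
apply: (@tens_linear_eq _ _ _ _ ((@eps2 K D : tens D D -> K^o) \o tmap f f) (@eps2 K C : tens C C
  -> K^o)) => a b.
by rewrite /= tmapE !eps2E !feps.
Qed.

Lemma tder_natural (V W : gvect K) (f : {linear V -> W}) (dV : {linear V -> V})
    (dW : {linear W -> W}) t :
  has_degree 0 f -> (forall v, f (dV v) = dW (f v)) ->
  tder dW (tmap f f t) = tmap f f (tder dV t).
Proof.
move=> f0 fd; rewrite /tder linearD /= -!tmap_comp.
by congr (_ + _); apply: eq_tmap => x /=; rewrite ?fd ?koszul_natural.
Qed.

Lemma ucoalg_hom_inverse (C D : ucoalg K) (f : {linear C -> D}) (g : {linear D -> C}) :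
  cancel f g -> cancel g f -> is_ucoalg_hom f -> is_ucoalg_hom g.
Proof.
move=> fK gK [f0 fDelta feps f1]; split=> [i x hx|x|x|]; last 3 first.
- rewrite -{2}[x]gK fDelta -tmap_comp -[LHS]tmap_id.
  by apply: eq_tmap => y /=; rewrite fK.
- by rewrite -feps gK.
- by rewrite -f1 fK.
rewrite /homog addr0; apply: (can_inj fK).
by rewrite -(has_degree_gcomp _ _ f0) addr0 gK.
Qed.

Lemma dg_bialgebra_transport (C D : ucoalg K) (f : {linear C -> D}) (g : {linear D -> C})
    (m : {linear tens D D -> D}) (d : {linear D -> D}) :
  cancel f g -> cancel g f -> is_ucoalg_hom f -> dg_bialgebra m d ->
  dg_bialgebra (g \o m \o tmap f f) (g \o d \o f).
Proof.
move=> fK gK fhom [m0 [mA m1l m1r] mDelta meps d0 dd d1 dm dDelta].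
have ghom := ucoalg_hom_inverse fK gK fhom.
have [f0 fDelta feps f1] := fhom; have [g0 gDelta geps g1] := ghom.
have fd v : f ((g \o d \o f) v) = d (f v) by rewrite /= gK.
split.
- exact: has_degree_comp (has_degree_comp g0 m0) (has_degree_tmap f0 f0).
- by split=> [a b c|a|a]; rewrite /= !tmapE ?gK ?mA ?f1 ?m1l ?m1r ?fK.
- move=> t; rewrite /= gDelta mDelta Delta2_natural //.
  by rewrite -!tmap_comp.
- by move=> t; rewrite /= geps meps eps2_natural.
- by move=> i x /f0; rewrite addr0 => /d0 /g0; rewrite addr0.
- by move=> x; rewrite /= gK dd linear0.
- by rewrite /= f1 d1 linear0.
- by move=> t; rewrite /= gK dm (tder_natural _ f0 fd).
- by move=> x; rewrite /= gDelta dDelta fDelta (tder_natural _ f0 fd) -tmap_comp (eq_tmap _ (fK :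
  g \o f =1 id) (fK : g \o f =1 id)) tmap_id.
Qed.

Lemma linear_inverse (U V : lmodType K) (f : {linear U -> V}) :
  bijective f -> exists g : {linear V -> U}, cancel f g /\ cancel g f.
Proof.
move=> [g fK gK].
pose h : {linear V -> U} := HB.pack g (GRing.isLinear.Build _ _ _ _ g (can2_linear fK gK)).
by exists h.
Qed.

(** The linear map is a tensor power of [f]; it is not named because only its
    linearity matters below. *)
Lemma rDelta_iter_natural (C D : ucoalg K) (f : {linear C -> D}) r :
  is_ucoalg_hom f -> exists g : {linear tpow C r -> tpow D r},
    forall x, rDelta_iter r (f x) = g (rDelta_iter r x).
Proof.
move=> [_ fDelta _ f1]; elim: r => [|r [g IH]]; first by exists f.
exists (tmap f g) => x.
have -> : rDelta_iter r.+1 (f x) = tmap idfun (@rDelta_iter K D r) (tmap f f (rDelta x)).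
  by rewrite /= /rDelta fDelta !linearB /= !tmapE /= f1.
by rewrite /= -!tmap_comp; apply: eq_tmap => // y; exact: IH.
Qed.

Lemma conilpotent_of_iso (C D : ucoalg K) (f : {linear C -> D}) :
  bijective f -> is_ucoalg_hom f -> conilpotent D -> conilpotent C.
Proof.
move=> /linear_inverse [g [fK gK]] fhom nilD x ex.
have [_ _ feps _] := fhom.
have [r hr] := nilD (f x) (etrans (feps x) ex); exists r.
have [h hE] := rDelta_iter_natural r (ucoalg_hom_inverse fK gK fhom).
by rewrite -[x]fK hE hr linear0.
Qed.

End Naturality.

(** * Conilpotent infinitesimal bialgebras are tensor coalgebras *)

Section PrimitiveSpace.
Variables (K : fieldType) (C : ucoalg K).

Definition is_prim : {pred C} := fun x => `[< primitive x >].

Fact is_prim_submod : submod_closed is_prim.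
Proof.
split=> [|a x y /asboolP px /asboolP py]; apply/asboolP; rewrite /primitive.
  by rewrite !linear0 pure0l addr0.
by rewrite linearP px py pureDl pureDr scalerDr addrACA.
Qed.
HB.instance Definition _ := GRing.isSubmodClosed.Build K C is_prim is_prim_submod.

Inductive prim : predArgType := Prim x & x \in is_prim.
Definition prim_val (x : prim) : C := let: Prim v _ := x in v.
HB.instance Definition _ := [isSub of prim for prim_val].
HB.instance Definition _ := [Choice of prim by <:].
HB.instance Definition _ := [SubChoice_isSubLmodule of prim by <:].

Lemma primP (x : prim) : primitive (val x).
Proof. by case: x => x /= /asboolP. Qed.

(** [Delta] and the maps [v |-> v ⊗ 1] and [v |-> 1 ⊗ v] have degree 0, so the
    homogeneous components of a primitive element are primitive. *)
Fact gcomp_prim i (x : prim) : gcomp C i (val x) \in is_prim.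
Proof.
have natural (W : gvect K) (f : {linear C -> W}) : has_degree 0 f ->
    f (gcomp C i (val x)) = gcomp W i (f (val x)).
  by move=> f0; rewrite -(has_degree_gcomp _ _ f0) addr0.
have right_one0 : has_degree 0 (pure_right uone : C -> tens C C).
  by move=> j v hv; apply: homog_pure => //; exact: uone_degree.
have left_one0 : has_degree 0 (pure uone : C -> tens C C).
  by move=> j v hv; rewrite addrC; apply: homog_pure => //; exact: uone_degree.
apply/asboolP; rewrite /primitive natural; last exact: Delta_degree.
by rewrite primP linearD -(natural _ _ right_one0) -(natural _ _ left_one0).
Qed.

Definition prim_gcomp i (x : prim) : prim := Prim (gcomp_prim i x).

Fact prim_gcomp_linear i : linear (prim_gcomp i).
Proof. by move=> a x y; apply: val_inj; rewrite linearP /= !linearP. Qed.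
HB.instance Definition _ i :=
  GRing.isLinear.Build K prim prim *:%R (prim_gcomp i) (prim_gcomp_linear i).

Fact prim_gcompK i j x :
  prim_gcomp i (prim_gcomp j x) = if i == j then prim_gcomp j x else 0.
Proof. by apply: val_inj; rewrite /= gcompK; case: ifP => // _; rewrite linear0. Qed.

Fact prim_gcompS x : exists2 s : seq int, uniq s & x = \sum_(i <- s) prim_gcomp i x.
Proof.
have [s us vx] := gcompS (val x); exists s => //; apply: val_inj.
by rewrite linear_sum {1}vx.
Qed.

Definition prim_gvect : gvect K := GVect prim_gcompK prim_gcompS.

Definition prim_incl (x : prim_gvect) : C := val (x : prim).

Fact prim_incl_linear : linear prim_incl.
Proof. exact: (linearP (val : prim -> C)). Qed.
HB.instance Definition _ := GRing.isLinear.Build K prim_gvect C *:%R prim_incl prim_incl_linear.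

Lemma prim_inclP x : primitive (prim_incl x).
Proof. exact: primP. Qed.

End PrimitiveSpace.

Section LodayRonco.
Variables (K : fieldType) (C : ucoalg K) (m : {linear tens C C -> C}).
Hypotheses (nilC : conilpotent C) (infm : unital_infinitesimal m).
Local Notation X := (prim_gvect C).
Local Notation T := (tcoalg X).

Definition mul_word (w : seq X) : C := foldr (fun x v => m (prim_incl x ⊗ v)) uone w.

Fact mul_word_multilin : multilin mul_word.
Proof.
move=> u v a x y; elim: u => [|z u IH] /=; last by rewrite IH !linearP.
by rewrite linearP pureDl linearP.
Qed.

Definition mul_map : T -> C := wlift mul_word.
HB.instance Definition _ := GRing.isLinear.Build K T C *:%R
  mul_map (wlift_linear mul_word_multilin).

Lemma mul_mapE w : mul_map (word w) = mul_word w.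
Proof. exact: wlift_word mul_word_multilin. Qed.

Lemma mul_map_one : mul_map uone = uone.
Proof. exact: mul_mapE. Qed.

Lemma mul_map_tcons x (t : T) : mul_map (tcons x t) = m (prim_incl x ⊗ mul_map t).
Proof.
apply: (@talg_linear_eq _ _ _ (mul_map \o (tcons x : T -> T)) (m \o pure (prim_incl x) \o
  mul_map) _ t) => w.
by rewrite /= tcons_wordE !mul_mapE.
Qed.

Lemma mul_map_degree : has_degree 0 m -> has_degree 0 mul_map.
Proof.
move=> m0; apply: has_degree_span (@gtalg_span K X) => _ [d [w [hw ->]]].
exists d; first exact: homog_hword.
rewrite /= addr0 mul_mapE; elim: hw => [|i {}d x {}w hx _ IH] /=; first exact: uone_degree.
rewrite -[i + d]addr0; apply: m0; apply: homog_pure => //.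
exact: (congr1 val hx).
Qed.

Lemma mul_map_Delta t : Delta (mul_map t) = tmap mul_map mul_map (Delta t).
Proof.
suff main w : Delta (mul_map (word w)) = tmap mul_map mul_map (Delta (word w : T)).
  exact: (@talg_linear_eq _ _ _ (Delta \o mul_map) (tmap mul_map mul_map \o @Delta _ T) main t).
elim: w => [|x w IH].
  rewrite mul_mapE Delta_one [RHS](congr1 (tmap mul_map mul_map) (Delta_one T)).
  by rewrite tmapE; congr (_ ⊗ _); rewrite [RHS]mul_map_one.
rewrite -tcons_wordE mul_map_tcons (Delta_mul_primitive infm _ (prim_inclP _)) IH Delta_tcons.
rewrite [RHS](linearD (tmap mul_map mul_map)) [X in _ = X + _]tmapE [X in _ = X ⊗ _ +
  _]mul_map_one [X in _ = _ ⊗ X + _]mul_map_tcons; congr (_ + _).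
rewrite -[LHS]tmap_comp -[RHS]tmap_comp.
by apply: eq_tmap => s //=; rewrite mul_map_tcons.
Qed.

Lemma mul_map_eps t : eps (mul_map t) = eps t.
Proof.
apply: (@talg_linear_eq _ _ _ (eps \o mul_map) (@eps _ T) _ t) => -[|x w] /=.
  by rewrite mul_mapE eps_one tcoalg_epsE.
by rewrite mul_mapE /= (eps_mul_primitive infm _ (prim_inclP _)) tcoalg_epsE.
Qed.

Lemma mul_map_conc t : mul_map (conc t) = m (tmap mul_map mul_map t).
Proof.
have [[mA m1l _] _] := infm.
apply: (@tens_linear_eq _ _ _ _ (mul_map \o @conc _ X) (m \o tmap mul_map mul_map) _ t) => s {}t.
rewrite /= tmapE.
apply: (@talg_linear_eq _ _ _ (mul_map \o @conc _ X \o pure_right t)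
  (m \o pure_right (mul_map t) \o mul_map) _ s) => w.
rewrite /= /pure_right conc_wordl mul_mapE; elim: w => [|x w IH] /=; first by rewrite m1l.
by rewrite mul_map_tcons IH mA.
Qed.

Section Inverse.
Variable p : {linear C -> C}.
Hypothesis pE : forall x, p x = red x - conv m red p x.

Fact proj_in_prim x : p x \in @is_prim K C.
Proof. by apply/asboolP; exact: (proj_primitive nilC infm pE). Qed.

Definition proj (x : C) : X := Prim (proj_in_prim x).
Fact proj_linear : linear proj.
Proof. by move=> a x y; apply: val_inj; rewrite linearP /= linearP. Qed.
HB.instance Definition _ := GRing.isLinear.Build K C X *:%R proj proj_linear.

Lemma proj_mul x v : proj (m (prim_incl x ⊗ v)) = (eps v : K) *: x.
Proof. by apply: val_inj; rewrite linearZ /= (proj_mul_primitive infm pE _ (prim_inclP _)). Qed.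

(** The formula [v = eps(v) 1 + p(v1) v2] iterated [n] times and then cut off by
    the counit; on a product of at most [n] primitives nothing is lost. *)
Fixpoint split_approx n : {linear C -> T} :=
  if n is k.+1 then unit_map uone \+ conv (@cons_map _ X) proj (split_approx k)
  else unit_map uone.

Lemma proj_map_one : proj uone = 0.
Proof. by apply: val_inj; rewrite /= (proj_one pE). Qed.

Lemma split_approx_one n : split_approx n uone = uone.
Proof.
case: n => [|n]; first exact: unit_map_one.
by rewrite [LHS]/= conv_one [X in X ⊗ _]proj_map_one pure0l linear0 addr0 unit_map_one.
Qed.

Lemma split_approx_mul n x v :
  split_approx n.+1 (m (prim_incl x ⊗ v)) = tcons x (split_approx n v).
Proof.
rewrite [LHS]/= /unit_map (eps_mul_primitive infm _ (prim_inclP _)) scale0r add0r.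
rewrite convE (Delta_mul_primitive infm _ (prim_inclP _)) linearD linearD /= tmapE [X in X ⊗
  _]proj_map_one pure0l linear0 add0r.
rewrite -tmap_comp.
have -> : tmap (proj \o (m \o pure (prim_incl x))) (split_approx n \o idfun) (Delta v) =
    tmap (unit_map x) (split_approx n) (Delta v).
  by apply: eq_tmap => // u; exact: proj_mul.
by rewrite tmap_unit_l cons_mapE.
Qed.

Lemma split_approx_word n w : (size w <= n)%N -> split_approx n (mul_word w) = word w.
Proof.
elim: n w => [|n IH] [|x w] //; try by move=> _; exact: split_approx_one.
by move=> /IH {}IH; rewrite [mul_word _]/= split_approx_mul IH tcons_wordE.
Qed.

(** [split_approx k] is a left inverse on words of length at most [k]. *)
Lemma mul_map_inj : injective mul_map.
Proof.
move=> s t /eqP; rewrite -subr_eq0 -linearB => /eqP st; apply/eqP; rewrite -subr_eq0; apply/eqP.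
have [n nP] : exists n, forall k, (n <= k)%N -> split_approx k (mul_map (s - t)) = s - t.
  elim/talg_ind: (s - t) => [|a w u [n IH]]; first by exists 0 => k _; rewrite !linear0.
  exists (n + size w)%N => k nk; rewrite !linearP /= IH ?(leq_trans (leq_addr _ _) nk) //.
  by rewrite mul_mapE split_approx_word // (leq_trans (leq_addl _ _) nk).
by rewrite -(nP n) // st linear0.
Qed.

Lemma mul_map_cons_map t : mul_map (cons_map t) = m (tmap (@prim_incl K C) mul_map t).
Proof.
apply: (@tens_linear_eq _ _ _ _ (mul_map \o @cons_map _ X) (m \o tmap (@prim_incl K C) mul_map) _
  t) => x s.
by rewrite /= cons_mapE tmapE mul_map_tcons.
Qed.

(** The error [D n] of the [n]-th approximation satisfies [D (n + 1) = p * D n], since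
    [p * id = red]; by conilpotency it vanishes on [v] for large [n]. *)
Lemma mul_map_surj v : exists t, mul_map t = v.
Proof.
have [|k|k y|n nP] := @conv_rec_eventually0 _ C _ _ m p
  (fun k => idfun \- (mul_map \o split_approx k)) v nilC.
- exact: proj_one pE.
- by rewrite /= split_approx_one mul_mapE subrr.
- rewrite conv_subr (conv_proj_id nilC infm pE) redE [LHS]/= linearD /= opprD addrA.
  congr (_ - _ - _); first by rewrite /unit_map linearZ /= mul_mapE.
  rewrite convE mul_map_cons_map -tmap_comp convE.
  by congr (m _); apply: eq_tmap.
by exists (split_approx n v); apply/esym/eqP; rewrite -subr_eq0; apply/eqP; exact: nP.
Qed.

End Inverse.
End LodayRonco.

(** The theorem of Loday and Ronco; [X] is the space of primitive elements and
    [f] multiplies the letters of a word. *)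
Theorem conilpotent_infinitesimal_tensor (K : fieldType) (C : ucoalg K)
    (m : {linear tens C C -> C}) :
  conilpotent C -> unital_infinitesimal m -> has_degree 0 m ->
  exists (X : gvect K) (f : {linear tcoalg X -> C}),
    [/\ bijective f, is_ucoalg_hom f & forall t, f (conc t) = m (tmap f f t)].
Proof.
move=> nilC infm m0; have [p pE] := primitive_projection_exists m nilC.
exists (prim_gvect C), (mul_map m); split; last exact: mul_map_conc.
  have [q qK] := choice (mul_map_surj nilC infm pE).
  exists q => [t|v]; last exact: qK.
  by apply: (mul_map_inj nilC infm pE); exact: qK.
split; [exact: mul_map_degree|exact: mul_map_Delta|exact: mul_map_eps|exact: mul_map_one].
Qed.

(** * Coalgebra maps and coderivations of tensor coalgebras *)

Section Cogeneration.
Variable K : fieldType.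

Lemma tcoalg_one_proj (X : gvect K) : wproj1 (uone : tcoalg X) = 0.
Proof. by rewrite wproj1E. Qed.

Lemma koszul_one (C : ucoalg K) k : koszul C k uone = uone.
Proof. by rewrite (koszulE _ (uone_degree C)) mulr0 scale1r. Qed.

Lemma eps_koszul (C : ucoalg K) k x : eps (koszul C k x) = eps x.
Proof.
apply: (@span_linear_eq _ _ _ _ (@eps K C \o koszul C k) (@eps K C) _ _ (homog_span x)) => u [i hu].
rewrite /= (koszulE _ hu) linearZ /=; have [->|i0] := eqVneq i 0.
  by rewrite mulr0 scale1r.
by rewrite (eps_degree hu i0) scaler0.
Qed.

(** Applying the counit to both factors of the coderivation rule gives
    [eps d = eps d + eps d]. *)
Lemma eps_coderivation (C : ucoalg K) (d : {linear C -> C}) x :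
  (forall y, Delta (d y) = tder d (Delta y)) -> eps (d x) = 0.
Proof.
move=> dD; have := congr1 (eps \o @contract_l _ C _) (dD x).
rewrite /= contract_l_Delta /tder linearD linearD /=.
have -> : eps (contract_l (tmap d idfun (Delta x))) = eps (d x).
  rewrite -{2}[x]contract_r_Delta.
  apply: (@tens_linear_eq _ _ _ _ (eps \o @contract_l _ C _ \o tmap d idfun)
    (eps \o d \o @contract_r _ C _) _ (Delta x)) => a b.
  by rewrite /= tmapE contract_lE contract_rE !linearZ /=; exact: mulrC.
have -> : eps (contract_l (tmap (koszul C (-1)) d (Delta x))) = eps (d x).
  rewrite -{2}[x]contract_l_Delta.
  apply: (@tens_linear_eq _ _ _ _ (eps \o @contract_l _ C _ \o tmap (koszul C (-1)) d)
    (eps \o d \o @contract_l _ C _) _ (Delta x)) => a b.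
  by rewrite /= tmapE contract_lE contract_lE !linearZ /= eps_koszul.
by move/eqP; rewrite -subr_eq subrr => /eqP.
Qed.

(** The defect [D = f dC - dY f] is a coderivation along [f] without letter
    component, so splitting off the first letter leaves the recursion
    [D = (wproj1 f koszul) * D]. *)
Lemma coderivation_cogenerated (C : ucoalg K) (Y : gvect K) (f : {linear C -> tcoalg Y})
    (dC : {linear C -> C}) (dY : {linear tcoalg Y -> tcoalg Y}) x :
  conilpotent C -> is_ucoalg_hom f -> dC uone = 0 -> dY uone = 0 ->
  (forall y, Delta (dC y) = tder dC (Delta y)) ->
  (forall y, Delta (dY y) = tder dY (Delta y)) ->
  (forall y, wproj1 (f (dC y)) = wproj1 (dY (f y))) -> f (dC x) = dY (f x).
Proof.
move=> nilC [f0 fDelta feps f1] dC1 dY1 DdC DdY pfd.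
apply/eqP; rewrite -subr_eq0; apply/eqP.
pose D : {linear C -> tcoalg Y} := (f \o dC) \- (dY \o f).
apply: (@conv_fixpoint_eq0 K C _ _ (@cons_map K Y)
  (@wproj1 K Y \o f \o koszul C (-1)) D) => //.
- by rewrite /= koszul_one f1 tcoalg_one_proj.
- by rewrite /= dC1 f1 dY1 linear0 subrr.
move=> {}x; rewrite {1}[D x]split_first_letter.
have -> : eps (D x) = 0.
  by rewrite linearB /= feps (eps_coderivation _ DdC) (eps_coderivation _ DdY) subrr.
rewrite scale0r add0r convE; congr (cons_map _).
have -> : Delta (D x) = tmap D f (Delta x) + tmap (f \o koszul C (-1)) D (Delta x).
  rewrite tmap_subl tmap_subr linearB /= fDelta DdC DdY fDelta /tder linearD /=.
  rewrite -!tmap_comp opprD addrACA; congr (_ - _ + (_ - _)); apply: eq_tmap => // y.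
  exact: koszul_natural.
rewrite linearD /= -!tmap_comp [X in X + _](_ : _ = 0) ?add0r; first exact: eq_tmap.
apply: (@tens_linear_eq _ _ _ _ (tmap ((@wproj1 K Y : tcoalg Y -> Y) \o D) (idfun \o f)) \0 _
  (Delta x)) => a b.
by rewrite /= tmapE /= linearB /= pfd subrr pure0l.
Qed.

(** Splitting off the first letter expresses the difference [D] of the two maps on
    a pair of words by its values on pairs of right parts. The total length drops
    unless both left parts are empty, and that term has no letter component; so
    induction on the total length applies. Homogeneous words are used because the
    sign in [Delta2] is only explicit on them. *)
Lemma coalgebra_map2_cogenerated (X Y : gvect K)
    (F G : {linear tens (tcoalg X) (tcoalg X) -> tcoalg Y}) :
  (forall t, Delta (F t) = tmap F F (Delta2 t)) ->
  (forall t, Delta (G t) = tmap G G (Delta2 t)) ->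
  (forall t, eps (F t) = eps (G t)) ->
  wproj1 (F (uone ⊗ uone)) = 0 ->
  (forall t, wproj1 (F t) = wproj1 (G t)) -> F =1 G.
Proof.
move=> DF DG eFG F1 pFG.
pose D : {linear tens (tcoalg X) (tcoalg X) -> tcoalg Y} := F \- G.
pose H : {linear tens (tens (tcoalg X) (tcoalg X)) (tens (tcoalg X) (tcoalg X)) -> tcoalg Y} :=
  @cons_map K Y \o tmap (@wproj1 K Y \o F) D.
have DE t : D t = H (Delta2 t).
  rewrite [D t]split_first_letter [eps _](_ : _ = 0) ?scale0r ?add0r; last first.
    by rewrite linearB /= eFG subrr.
  rewrite /H /=; congr (cons_map _); rewrite linearB /= DF DG linearB /= -!tmap_comp tmap_subr.
  by congr (_ - _); apply: eq_tmap => // y; exact/esym/pFG.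
have D0 n u w d e : (size u + size w < n)%N -> hword d u -> hword e w ->
    D ((word u : tcoalg X) ⊗ (word w : tcoalg X)) = 0.
  elim: n u w d e => [//|n IH] u w d e sn hu hw.
  rewrite DE /Delta2 tmapE !tcoalg_DeltaE pure_suml.
  pose L : {linear tens (tens (tcoalg X) (tcoalg X)) (tens (tcoalg X) (tcoalg X)) -> tcoalg Y} :=
    H \o @tinter K (tcoalg X) (tcoalg X) (tcoalg X) (tcoalg X).
  rewrite -[LHS]/(L _) linear_sum; apply: big1 => i _.
  rewrite pure_sumr linear_sum; apply: big1 => j _.
  have [d1 [d2 [hu1 hu2 _]]] := hword_split i hu.
  have [e1 [e2 [hw1 hw2 _]]] := hword_split j hw.
  rewrite /L /= (tinterE _ _ (homog_hword hu2) (homog_hword hw1)) !linearZ /= tmapE.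
  have [/eqP|ij] := posnP (i + j).
    rewrite addn_eq0 => /andP[/eqP -> /eqP ->]; rewrite !take0 /= F1 cons_mapE tcons0l.
    exact: scaler0.
  rewrite (IH _ _ _ _ _ hu2 hw2) ?linear0 ?scaler0 //.
  have iu : (i <= size u)%N by rewrite -ltnS.
  have jw : (j <= size w)%N by rewrite -ltnS.
  rewrite !size_drop -(ltn_add2r (i + j)) addnACA !subnK //.
  by apply: leq_trans sn _; rewrite -addn1 leq_add2l.
move=> t; apply/eqP; rewrite -subr_eq0; apply/eqP.
have spX := @gtalg_span K X.
apply: (@span_linear_eq _ _ _ _ D \0 _ _ (tens_span_span spX spX t)).
move=> _ [_ [_ [[d [u [hu ->]]] [e [w [hw ->]]] ->]]].
exact: (D0 _ _ _ _ _ (ltnSn _) hu hw).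
Qed.

End Cogeneration.

(** * The tensor coalgebra functor *)

Section TensorMap.
Variables (K : fieldType) (A B : gvect K) (f : {linear A -> B}).
Local Notation TA := (tcoalg A).
Local Notation TB := (tcoalg B).

Definition tfun_word (w : seq A) : TB := word (map f w).

Fact tfun_word_multilin : multilin tfun_word.
Proof. by move=> u v a x y; rewrite /tfun_word !map_cat /= linearP word_multilin. Qed.

Definition tfun : TA -> TB := wlift tfun_word.
HB.instance Definition _ := GRing.isLinear.Build K TA TB *:%R
  tfun (wlift_linear tfun_word_multilin).

Lemma tfunE w : tfun (word w) = word (map f w).
Proof. exact: wlift_word tfun_word_multilin. Qed.

Lemma wproj1_tfun t : wproj1 (tfun t) = f (wproj1 t).
Proof.
apply: (@talg_linear_eq _ _ _ ((@wproj1 K B : TB -> B) \o tfun) (f \o (@wproj1 K A : TA -> A)) _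
  t) => w.
by rewrite /= tfunE !wproj1E; case: w => [|x [|y w]] /=; rewrite ?linear0.
Qed.

Lemma hword_map d w : has_degree 0 f -> hword d w -> hword d (map f w).
Proof.
move=> f0; elim=> [|i {}d x {}w hx _ IH] /=; first exact: hword_nil.
by apply: hword_cons => //; rewrite -[i]addr0; exact: f0.
Qed.

Lemma tfun_hom : has_degree 0 f -> is_ucoalg_hom tfun.
Proof.
move=> f0; split=> [|t|t|]; last exact: tfunE.
- apply: has_degree_span (@gtalg_span K A) => _ [d [w [hw ->]]].
  exists d; first exact: homog_hword.
  by rewrite addr0 /= tfunE; apply: homog_hword; exact: hword_map.
- suff main w : Delta (tfun (word w)) = tmap tfun tfun (Delta (word w : TA)).
    exact: (@talg_linear_eq _ _ _ (Delta \o tfun) (tmap tfun tfun \o @Delta _ TA) main t).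
  rewrite tfunE !tcoalg_DeltaE linear_sum size_map; apply: eq_bigr => i _.
  by rewrite [RHS]tmapE /= !tfunE map_take map_drop.
- apply: (@talg_linear_eq _ _ _ (@eps K TB \o tfun) (@eps K TA) _ t) => w.
  by rewrite /= tfunE !tcoalg_epsE; case: w.
Qed.

Lemma tfun_conc t : tfun (conc t) = conc (tmap tfun tfun t).
Proof.
apply: (@tens_linear_eq _ _ _ _ (tfun \o @conc K A) (@conc K B \o tmap tfun tfun) _ t) => s {}t.
rewrite /= tmapE /=.
apply: (@talg_linear_eq _ _ _ (tfun \o @conc K A \o pure_right t)
  (@conc K B \o pure_right (tfun t) \o tfun) _ s) => u.
apply: (@talg_linear_eq _ _ _ (tfun \o @conc K A \o pure (word u : TA))
  (@conc K B \o pure (tfun (word u)) \o tfun) _ t) => w.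
by rewrite /= concE !tfunE concE map_cat.
Qed.

End TensorMap.

Lemma conc_degree (K : fieldType) (X : gvect K) : has_degree 0 (@conc K X).
Proof.
have spX := @gtalg_span K X.
apply: has_degree_span (tens_span_span spX spX) => _ [_ [_ [[d [u [hu ->]]] [e [w [hw ->]]] ->]]].
exists (d + e); first by apply: homog_pure; exact: homog_hword.
rewrite addr0 /= concE; apply: homog_hword.
elim: hu => [|i {}d x {}u hx _ IH] /=; first by rewrite add0r.
by rewrite -addrA; exact: hword_cons.
Qed.

Section TensorFunctor.
Variable K : fieldType.

Definition tensor_biass (A : binfty K) : biass K :=
  Biass (bi_axioms A) (@conc_degree K A) (@conc_infinitesimal K A).

(** The structure maps are the letter components of differential and product, so
    both compatibilities follow by cogeneration; words of length 0, on which no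
    structure map is defined, are covered by the unit axioms. *)
Lemma tfun_biass_hom (A B : binfty K) (f : {linear A -> B}) :
  is_binfty_hom f -> @is_biass_hom K (tensor_biass A) (tensor_biass B) (tfun f).
Proof.
move=> [f0 fm fmm].
have hom := tfun_hom f0; have [h0 hD he h1] := hom.
have [muA0 [muAA muA1 muA1r] muAD muAe _ _ dA1 _ dAD] := bi_axioms A.
have [muB0 [muBA muB1 muB1r] muBD muBe _ _ dB1 _ dBD] := bi_axioms B.
split=> //= [x|t|t]; last exact: tfun_conc.
- apply: (coderivation_cogenerated _ (@tcoalg_conilpotent K A) hom dA1 dB1 dAD dBD) => {}x.
  rewrite wproj1_tfun.
  apply: (@talg_linear_eq _ _ _ (f \o (@wproj1 K A : tcoalg A -> A) \o bi_d A)
    ((@wproj1 K B : tcoalg B -> B) \o bi_d B \o tfun f) _ x) => -[|y w].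
    rewrite /= tfunE [bi_d A _]dA1 [bi_d B _]dB1 !linear0 //.
  by rewrite /= tfunE; exact: (fm _ (in_tuple (y :: w))).
apply: (@coalgebra_map2_cogenerated _ _ _ (tfun f \o bi_mu A)
  (bi_mu B \o tmap (tfun f) (tfun f))) => [{}t|{}t|{}t||{}t].
- by rewrite /= hD muAD -tmap_comp.
- by rewrite [LHS]muBD [X in tmap _ _ X](Delta2_natural t hom) -tmap_comp.
- by rewrite /= he muAe muBe [RHS](eps2_natural t hom).
- by rewrite /= muA1 h1 tcoalg_one_proj.
rewrite /= wproj1_tfun.
apply: (@tens_linear_eq _ _ _ _ (f \o (@wproj1 K A : tcoalg A -> A) \o bi_mu A)
    ((@wproj1 K B : tcoalg B -> B) \o bi_mu B \o tmap (tfun f) (tfun f)) _ t) => u v.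
rewrite [LHS]/= [RHS]/= tmapE.
apply: (@talg_linear_eq _ _ _ (f \o (@wproj1 K A : tcoalg A -> A) \o bi_mu A \o pure_right v)
    ((@wproj1 K B : tcoalg B -> B) \o bi_mu B \o pure_right (tfun f v) \o tfun f) _ u) => -[|x s].
  rewrite [LHS]/= [RHS]/= tfunE !pure_rightE.
  rewrite [X in f (wproj1 X)]muA1 [X in _ = wproj1 X]muB1.
  by rewrite wproj1_tfun.
apply: (@talg_linear_eq _ _ _ (f \o (@wproj1 K A : tcoalg A -> A) \o bi_mu A \o pure (word (x ::
  s) : tcoalg A))
    ((@wproj1 K B : tcoalg B -> B) \o bi_mu B \o pure (tfun f (word (x :: s))) \o tfun f) _ v) =>
      -[|y w].
  rewrite [LHS]/= [RHS]/= (tfunE _ [::]).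
  rewrite [X in f (wproj1 X)]muA1r [X in _ = wproj1 X]muB1r.
  by rewrite wproj1_tfun.
rewrite [LHS]/= [RHS]/= !tfunE.
exact: (fmm _ _ (in_tuple (x :: s)) (in_tuple (y :: w))).
Qed.

Definition letter (A : gvect K) (x : A) : tcoalg A := word [:: x].

Fact letter_linear (A : gvect K) : linear (@letter A).
Proof. by move=> a x y; exact: (word_multilin [::] [::]). Qed.
HB.instance Definition _ (A : gvect K) :=
  GRing.isLinear.Build K A (tcoalg A) *:%R (@letter A) (@letter_linear A).

Lemma letter_degree (A : gvect K) : has_degree 0 (@letter A).
Proof.
move=> i x hx; rewrite addr0 -[i]addr0; apply: homog_hword.
by apply: hword_cons => //; exact: hword_nil.
Qed.

Lemma wproj1_degree (A : gvect K) : has_degree 0 (@wproj1 K A : tcoalg A -> A).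
Proof.
apply: has_degree_span (@gtalg_span K A) => _ [d [w [hw ->]]].
exists d; first exact: homog_hword.
rewrite addr0 /= wproj1E; case: hw => [|i {}d x [|y {}w] hx hw] /=; try exact: linear0.
by inversion hw; rewrite addr0.
Qed.

Lemma letter_primitive (A : gvect K) (x : A) : primitive (letter x).
Proof. by rewrite /primitive tcoalg_DeltaE !big_ord_recl big_ord0 /= addr0 addrC. Qed.

Lemma primitive_tcoalg (A : gvect K) (t : tcoalg A) : primitive t -> t = letter (wproj1 t).
Proof.
move=> pt; rewrite [LHS]split_first_letter (eps_primitive pt) scale0r add0r pt linearD /= !tmapE.
by rewrite linearD /= !cons_mapE [wproj1 (word _)]tcoalg_one_proj tcons0l addr0 tcons_wordE.
Qed.

Lemma primitive_hom (C D : ucoalg K) (f : {linear C -> D}) x :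
  is_ucoalg_hom f -> primitive x -> primitive (f x).
Proof. by move=> [_ fD _ f1] px; rewrite /primitive fD px linearD /= !tmapE f1. Qed.

(** A homomorphism maps letters to letters because these are the primitive
    elements, and words are concatenations of letters. *)
Lemma biass_hom_tfun (A B : binfty K) (g : {linear tcoalg A -> tcoalg B}) :
  @is_biass_hom K (tensor_biass A) (tensor_biass B) g ->
  g =1 tfun ((@wproj1 K B : tcoalg B -> B) \o g \o @letter A).
Proof.
move=> [/= hom _ _ gconc]; apply: talg_linear_eq; have [_ _ _ g1] := hom.
elim=> [|x w IH]; first by rewrite /= tfunE; exact: g1.
have -> : word (x :: w) = conc (letter x ⊗ (word w : tcoalg A)) by rewrite concE.
rewrite [LHS]gconc [RHS]tfun_conc /= !tmapE; congr (conc (_ ⊗ _)); last exact: IH.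
by rewrite [RHS]tfunE; exact/primitive_tcoalg/primitive_hom/letter_primitive.
Qed.

Lemma biass_hom_binfty_hom (A B : binfty K) (g : {linear tcoalg A -> tcoalg B}) :
  @is_biass_hom K (tensor_biass A) (tensor_biass B) g ->
  is_binfty_hom ((@wproj1 K B : tcoalg B -> B) \o g \o @letter A).
Proof.
move=> ghom; have gE := biass_hom_tfun ghom.
have [[g0 _ _ _] /= gd gmu _] := ghom.
set f := (f in tfun f) in gE *.
have pg t : f (wproj1 t) = wproj1 (g t) by rewrite gE wproj1_tfun.
have gw w : g (word w) = word (map f w) by rewrite gE tfunE.
split=> [|n t _|i j s t _ _].
- exact: has_degree_comp (@wproj1_degree B) (has_degree_comp g0 (@letter_degree A)).
- by rewrite /bi_m [LHS]pg gd gw.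
- by rewrite /bi_mm [LHS]pg gmu tmapE /= !gw.
Qed.

End TensorFunctor.

(** * Equivalences of categories *)

(** The quasi-inverse is built from chosen preimages of objects, up to
    isomorphism, and of morphisms. *)
Lemma fully_faithful_surjective_equivalent (C D : category) (F : functor C D) :
  (forall a b (g : hom (F a) (F b)), exists f, fmap F f = g) ->
  (forall a b (f g : hom a b), fmap F f = fmap F g -> f = g) ->
  (forall d, exists c (u : hom (F c) d) (v : hom d (F c)),
    comp u v = idm d /\ comp v u = idm (F c)) ->
  equivalent C D.
Proof.
move=> full faith surj.
have H d : {c & {u : hom (F c) d & {v : hom d (F c) |
    comp u v = idm d /\ comp v u = idm (F c)}}}.
  by have [c /cid[u /cid[v uv]]] := cid (surj d); exists c, u, v.
pose G d := projT1 (H d); pose u d : hom (F (G d)) d := projT1 (projT2 (H d)).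
pose v d : hom d (F (G d)) := sval (projT2 (projT2 (H d))).
have uv d : comp (u d) (v d) = idm d by exact: (svalP (projT2 (projT2 (H d)))).1.
have vu d : comp (v d) (u d) = idm (F (G d)) by exact: (svalP (projT2 (projT2 (H d)))).2.
pose lift a b (g : hom (F a) (F b)) := sval (cid (full a b g)).
have liftE a b g : fmap F (@lift a b g) = g by exact: svalP (cid (full a b g)).
pose Gmap d e (h : hom d e) : hom (G d) (G e) := lift _ _ (comp (v e) (comp h (u d))).
have Gmap_id d : Gmap d d (idm d) = idm (G d).
  by apply: faith; rewrite liftE comp_idl vu fmap_id.
have Gmap_comp c d e (h : hom d e) (k : hom c d) :
    Gmap c e (comp h k) = comp (Gmap d e h) (Gmap c d k).
  apply: faith; rewrite fmap_comp !liftE -!compA; congr comp; congr comp.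
  by rewrite compA uv comp_idl.
exists F, (Functor Gmap_id Gmap_comp); split.
  exists (fun a => lift _ _ (u (F a))), (fun a => lift _ _ (v (F a))); split=> [a b f|a] /=.
    by apply: faith; rewrite !fmap_comp !liftE compA uv comp_idl.
  by split; apply: faith; rewrite fmap_comp !liftE fmap_id ?vu ?uv.
exists u, v; split=> [a b f|a] /=; last by split.
by rewrite liftE compA uv comp_idl.
Qed.

Lemma equivalent_refl (C : category) : equivalent C C.
Proof.
exists (idfunctor C), (idfunctor C).
have h : nat_isomorphic (fcompose (idfunctor C) (idfunctor C)) (idfunctor C).
  exists (fun a => idm a), (fun a => idm a); split=> [a b f|a] /=.
    by rewrite comp_idl comp_idr.
  by rewrite comp_idl.
by split.
Qed.

Section Categories.
Variable K : fieldType.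

Lemma conilpotent_cofree (V : biass K) : conilpotent V <-> cofree V.
Proof.
split=> [nilV|[X [f [bij fhom]]]]; last exact: conilpotent_of_iso bij fhom (@tcoalg_conilpotent K
  X).
have [X [f [bij fhom _]]] := conilpotent_infinitesimal_tensor nilV (ba_infinitesimal V)
  (@ba_odot_degree K V).
have [g [fK gK]] := linear_inverse bij.
exists X, g; split; first by exists f.
exact: ucoalg_hom_inverse fK gK fhom.
Qed.

Definition tensor_ob (A : ob (binfty_category K)) : ob (conilpotent_biass_category K) :=
  exist (fun V : biass K => conilpotent V) (tensor_biass A) (@tcoalg_conilpotent K A).

Definition tensor_map (A B : ob (binfty_category K)) (f : hom A B) :
    hom (tensor_ob A) (tensor_ob B) :=
  exist (fun g : {linear tcoalg A -> tcoalg B} => @is_biass_hom K (tensor_biass A) (tensor_biass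
    B) g)
    (tfun (sval f)) (tfun_biass_hom (svalP f)).

Lemma tensor_map_id A : tensor_map (idm A) = idm (tensor_ob A).
Proof. by apply: lhom_eq; apply: talg_linear_eq => w; rewrite /= tfunE map_id. Qed.

Lemma tensor_map_comp A B C (g : hom B C) (f : hom A B) :
  tensor_map (comp g f) = comp (tensor_map g) (tensor_map f).
Proof. by apply: lhom_eq; apply: talg_linear_eq => w; rewrite /= !tfunE map_comp. Qed.

Definition tensor_functor : functor (binfty_category K) (conilpotent_biass_category K) :=
  Functor tensor_map_id tensor_map_comp.

Lemma tensor_functor_full A B (g : hom (tensor_functor A) (tensor_functor B)) :
  exists f, fmap tensor_functor f = g.
Proof.
case: g => g ghom.
exists (exist _ ((@wproj1 K B : tcoalg B -> B) \o g \o @letter K A : {linear _ -> _})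
  (biass_hom_binfty_hom ghom)).
by apply: lhom_eq => t; exact/esym/(biass_hom_tfun ghom).
Qed.

Lemma tensor_functor_faithful A B (f g : hom A B) :
  fmap tensor_functor f = fmap tensor_functor g -> f = g.
Proof.
move=> fg; apply: lhom_eq => x.
have := congr1 (fun h : @lhom K (biass K) (fun V => V) (@is_biass_hom K) (tensor_biass A)
  (tensor_biass B) => @wproj1 K B (sval h (letter x))) fg.
by rewrite /= /letter !tfunE !wproj1E.
Qed.

(** The B-infinity structure on the primitive elements is the one transported from
    [V] along the isomorphism of Loday and Ronco. *)
Lemma tensor_functor_surjective V : exists A (u : hom (tensor_functor A) V)
    (v : hom V (tensor_functor A)), comp u v = idm V /\ comp v u = idm (tensor_functor A).
Proof.
case: V => V nilV.
have [X [f [bij fhom fconc]]] :=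
  conilpotent_infinitesimal_tensor nilV (ba_infinitesimal V) (@ba_odot_degree K V).
have [g [fK gK]] := linear_inverse bij.
have ghom := ucoalg_hom_inverse fK gK fhom.
pose A := Binfty (dg_bialgebra_transport fK gK fhom (ba_dg_bialgebra V)).
have tfg (t : tens V V) : tmap f f (tmap g g t) = t.
  by rewrite -tmap_comp (eq_tmap _ (gK : f \o g =1 id) (gK : f \o g =1 id)) tmap_id.
have fbi : @is_biass_hom K (tensor_biass A) V f.
  by split=> //= [x|t]; rewrite ?gK.
have gbi : @is_biass_hom K V (tensor_biass A) g.
  split=> //= [x|t|t]; rewrite ?gK ?tfg //.
  by apply: (can_inj fK); rewrite fconc tfg gK.
exists A, (exist _ f fbi), (exist _ g gbi).
by split; apply: lhom_eq => x /=; rewrite ?gK ?fK.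
Qed.

End Categories.

Theorem corollary3p3p4 (K : fieldType) :
  equivalent (binfty_category K) (conilpotent_biass_category K) /\
  equivalent (conilpotent_biass_category K) (cofree_biass_category K) /\
  equivalent (binfty_category K) (cofree_biass_category K).
Proof.
have E : equivalent (binfty_category K) (conilpotent_biass_category K).
  apply: (@fully_faithful_surjective_equivalent _ _ (tensor_functor K)).
  - exact: tensor_functor_full.
  - exact: tensor_functor_faithful.
  - exact: tensor_functor_surjective.
(* The two full subcategories are cut out by equivalent predicates. *)
have <- : conilpotent_biass_category K = cofree_biass_category K.
  congr full_subcategory; apply/funext => V; apply/propext; exact: conilpotent_cofree.
by split=> //; split=> //; exact: equivalent_refl.
Qed.
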